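(* Let $s>1$ and let $d\le4s$ be a positive integer. There exists a constant $C>0$, depending only on the fixed model parameters $(s,d,\mathcal U,p_-,p_+,L_s,v_-,v_+,C_4)$, such that, for every $n\ge1$, \[ C^{-1}n^{-1/2}\le\mathfrak r_n\le Cn^{-1/2}. \]
   Context: Fix $s>0$, an integer $d\ge1$, an open set $\mathcal U\subset\mathbb R^d$ containing $[0,1]^d$, and constants \[ 0<p_-<1<p_+<\infty,\quad L_s>0,\quad 0<v_-<v_+<\infty,\quad v_-^2<C_4<\infty . \] Hölder norm. Set $\ell=\lceil s\rceil-1$ and $\alpha=s-\ell\in(0,1]$. For a scalar function $F$ on an open set $\Omega\subset\mathbb R^d$, \[ [D^\ell F]_{\alpha;\Omega}=\max_{|\gamma|=\ell}\sup_{u\ne v\in\Omega}\frac{|\partial^\gamma F(u)-\partial^\gamma F(v)|}{\|u-v\|^\alpha},\qquad \|F\|_{C^s(\Omega)}=\sum_{|\gamma|\le\ell}\|\partial^\gamma F\|_{L^\infty(\Omega)}+[D^\ell F]_{\alpha;\Omega}, \] with $\|\cdot\|$ the Euclidean norm (so for integer $s$, $C^s$ means $C^{s-1,1}$). Model. For each $n\in\mathbb N$ one observes i.i.d. pairs $(X_i,Y_i)_{i=1}^n$ in $[0,1]^d\times\mathbb R$, whose common law is indexed by $\theta=(p,f,V,Q)$, where $p$ is a probability density on $[0,1]^d$, $f:[0,1]^d\to\mathbb R$, $V>0$, and $Q=(Q_x)_{x\in[0,1]^d}$ is a measurable probability kernel from $[0,1]^d$ to $\mathbb R$; write $\varepsilon_i=Y_i-f(X_i)$.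 The class $\Theta=\Theta(s,d,\mathcal U,p_-,p_+,L_s,v_-,v_+,C_4)$ consists of all $\theta$ such that: (i) $X_i$ has Lebesgue density $p$ and $p_-\le p(x)\le p_+$ for a.e. $x\in[0,1]^d$; (ii) $f$ has an extension $\widetilde f$ to $\mathcal U$ with $\|\widetilde f\|_{C^s(\mathcal U)}\le L_s$; (iii) for $p(x)\,dx$-almost every $x$, the conditional law of $\varepsilon_i$ given $X_i=x$ is $Q_x$, with $\int u\,Q_x(du)=0$, $\int u^2\,Q_x(du)=V$, $\int u^4\,Q_x(du)\le C_4$, and $v_-\le V\le v_+$. ($V$ is constant in $x$; $Q_x$ may otherwise depend arbitrarily on $x$.) The minimax root-mean-square risk is \[ \mathfrak r_n=\inf_{\widehat V_n}\sup_{\theta\in\Theta}\bigl\{\mathbb E_\theta(\widehat V_n-V)^2\bigr\}^{1/2}, \] the infimum being over all measurable real-valued functions $\widehat V_n$ of $(X_i,Y_i)_{i=1}^n$. *)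

(* Defs.v *)
From HB Require Import structures.
From mathcomp Require Import all_boot all_order all_algebra.
From mathcomp Require Import all_classical all_reals all_analysis.
From mathcomp Require Import measurable_realfun.

Set Implicit Arguments.
Unset Strict Implicit.
Unset Printing Implicit Defensive.

Import Order.TTheory GRing.Theory Num.Theory.
Import numFieldNormedType.Exports.

Local Open Scope classical_set_scope.
Local Open Scope ring_scope.

(** The n-th power of a measure, on [n.-tuple T]: [tuple_measure mu n] is the
    n-fold product [mu \x ... \x mu], built by prepending one coordinate at a
    time. *)
Section tuple_measure.
Context d (T : measurableType d) (R : realType).
Variable mu : {sigma_finite_measure set T -> \bar R}.
Local Open Scope ereal_scope.

Section cons_measure.
Context n (nu : {measure set (n.-tuple T) -> \bar R}).

Definition cons_tuple (z : T * n.-tuple T) : n.+1.-tuple T :=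
  [tuple of z.1 :: z.2].

Lemma measurable_cons_tuple : measurable_fun setT cons_tuple.
Proof. exact: measurable_cons. Qed.

Definition cons_measure : set (n.+1.-tuple T) -> \bar R :=
  pushforward (mu \x^ nu) cons_tuple.

Let cons_measure0 : cons_measure set0 = 0%E.
Proof. by apply: measure0; exact: measurable_cons_tuple. Qed.

Let cons_measure_ge0 A : (0 <= cons_measure A)%E.
Proof. by apply: measure_ge0; exact: measurable_cons_tuple. Qed.

Let cons_measure_sigma_additive : semi_sigma_additive cons_measure.
Proof. by apply: measure_semi_sigma_additive; exact: measurable_cons_tuple. Qed.

HB.instance Definition _ := isMeasure.Build _ _ _ cons_measure
  cons_measure0 cons_measure_ge0 cons_measure_sigma_additive.

End cons_measure.

Fixpoint tuple_measure n : {measure set (n.-tuple T) -> \bar R} :=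
  match n with
  | 0 => \d_[tuple]
  | m.+1 => cons_measure (tuple_measure m)
  end.

End tuple_measure.

(** The product sigma-algebra on matrices, generated by the entries (for real
    entries this is also the Borel sigma-algebra). *)
Section measurable_matrix.
Context (R : realType) (m n : nat).

Let coors : 'I_m * 'I_n -> 'M[R]_(m, n) -> R := fun ij A => A ij.1 ij.2.

Definition mx_preimages : set_system 'M[R]_(m, n) :=
  \bigcup_ij preimage_set_system setT (coors ij) measurable.

HB.instance Definition _ := @isMeasurable.Build default_measure_display
  'M[R]_(m, n) <<s mx_preimages >> (@sigma_algebra0 _ _ _)
  (@sigma_algebraC _ _) (@sigma_algebra_bigcup _ _ _).

Lemma measurable_coor i j :
  measurable_fun setT (fun A : 'M[R]_(m, n) => A i j).
Proof.
move=> _ Y mY; apply: sub_sigma_algebra.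
by exists (i, j) => //; exists Y.
Qed.

Lemma measurable_fun_mx d (T : measurableType d) (f : T -> 'M[R]_(m, n)) :
  (forall i j, measurable_fun setT (fun x => f x i j)) ->
  measurable_fun setT f.
Proof.
move=> mf; apply: (@measurability _ _ _ _ _ _ mx_preimages) => //.
move=> _ [_ [[i j] _ [Y mY <-]] <-]; rewrite !setTI.
by have := mf i j measurableT Y mY; rewrite setTI.
Qed.

End measurable_matrix.

Section lebesgue_rV.
Context (R : realType) (d : nat).

Definition row_of_tuple (t : d.-tuple R) : 'rV[R]_d := \row_j tnth t j.

Lemma measurable_row_of_tuple : measurable_fun setT row_of_tuple.
Proof.
apply: measurable_fun_mx => i j.
rewrite (_ : (fun _ => _) = (@tnth d R ^~ j)); first exact: measurable_tnth.
by apply/funext => t; rewrite mxE.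
Qed.

(** d-dimensional Lebesgue measure *)
Definition lebesgue_rV : set 'rV[R]_d -> \bar R :=
  pushforward (tuple_measure (@lebesgue_measure R) d) row_of_tuple.

Let lebesgue_rV0 : lebesgue_rV set0 = 0%E.
Proof. by apply: measure0; exact: measurable_row_of_tuple. Qed.

Let lebesgue_rV_ge0 A : (0 <= lebesgue_rV A)%E.
Proof. by apply: measure_ge0; exact: measurable_row_of_tuple. Qed.

Let lebesgue_rV_sigma_additive : semi_sigma_additive lebesgue_rV.
Proof. by apply: measure_semi_sigma_additive; exact: measurable_row_of_tuple. Qed.

HB.instance Definition _ := isMeasure.Build _ _ _ lebesgue_rV
  lebesgue_rV0 lebesgue_rV_ge0 lebesgue_rV_sigma_additive.

Definition unit_cube : set 'rV[R]_d := [set x | forall i, 0 <= x ord0 i <= 1].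

Lemma measurable_unit_cube : measurable unit_cube.
Proof.
rewrite (_ : unit_cube =
  \bigcap_(i in [set: 'I_d]) ((fun x : 'rV[R]_d => x ord0 i) @^-1` `[0, 1])).
  apply: fin_bigcap_measurable; first exact: finite_finset.
  by move=> i _; rewrite -[X in measurable X]setTI; apply: measurable_coor.
apply/seteqP; split => x /= h i; first by move=> _ /=; rewrite in_itv /= h.
by have := h i I; rewrite /= in_itv.
Qed.

End lebesgue_rV.

Section holder.
Context (R : realType) (d : nat).
Implicit Types (F : 'rV[R]_d -> R) (O : set 'rV[R]_d) (s L : R) (k l : nat).

(** The norm [`|x|] of the library on ['rV[R]_d] is the sup norm. *)
Definition euclidean_norm (x : 'rV[R]_d) : R :=
  Num.sqrt (\sum_i x ord0 i ^+ 2).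

Definition basis_vector (i : 'I_d) : 'rV[R]_d := delta_mx ord0 i.

Definition iterated_partial (w : seq 'I_d) F : 'rV[R]_d -> R :=
  foldr (fun i G x => 'D_(basis_vector i) G x) F w.

(** [F] is of class C^k on the open set [O]. *)
Definition of_class (k : nat) O F : Prop :=
  forall w : seq 'I_d, (size w <= k)%N -> forall x, O x ->
    {for x, continuous (iterated_partial w F)} /\
    ((size w < k)%N ->
       forall i, derivable (iterated_partial w F) x (basis_vector i)).

(** Multi-indices with all entries at most [l]; those of order at most [l] are
    all of this form. *)
Definition order_mi l (g : {ffun 'I_d -> 'I_l.+1}) : nat := (\sum_i g i)%N.

Definition partial_mi l (g : {ffun 'I_d -> 'I_l.+1}) F : 'rV[R]_d -> R :=
  iterated_partial (flatten [seq nseq (g i) i | i <- enum 'I_d]) F.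

Local Open Scope ereal_scope.

Definition holder_seminorm l (alpha : R) O F : \bar R :=
  \big[maxe/0]_(g : {ffun 'I_d -> 'I_l.+1} | order_mi g == l)
    ereal_sup [set e | exists u v, [/\ O u, O v, u != v &
      e = (`|partial_mi g F u - partial_mi g F v|
           / (euclidean_norm (u - v)) `^ alpha)%:E]].

Definition holder_order s : nat := (`|Num.ceil s|%N).-1.
Definition holder_exponent s : R := (s - (holder_order s)%:R)%R.

Definition holder_norm s O F : \bar R :=
  \sum_(g : {ffun 'I_d -> 'I_(holder_order s).+1} |
        (order_mi g <= holder_order s)%N)
    'N[@lebesgue_rV R d]_+oo [EFin \o (partial_mi g F \_ O)]
  + holder_seminorm (holder_order s) (holder_exponent s) O F.

(** The derivatives used by [holder_norm] are total functions with junk values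
    where they do not exist, so regularity has to be required separately. *)
Definition holder_ball s O L : set ('rV[R]_d -> R) :=
  [set F | of_class (holder_order s) O F /\ holder_norm s O F <= L%:E].

End holder.

(** The parameter theta = (p, f, V, Q). Densities, regression functions and
    kernels on the unit cube are represented by total ones, of which only the
    restriction to the cube is ever used. Measurability of [regression] on the
    cube is needed for the joint law to make sense; it holds for any function
    with a continuous extension, hence for all those considered in the model. *)
Record param (R : realType) (d : nat) := Param {
  density : 'rV[R]_d -> R;
  regression : 'rV[R]_d -> R;
  noise_variance : R;
  noise : R.-pker 'rV[R]_d ~> R;
  measurable_density : measurable_fun (@unit_cube R d) density;
  density_ge0 : forall x, unit_cube x -> 0 <= density x;
  integral_density :
    (\int[@lebesgue_rV R d]_(x in @unit_cube R d) (density x)%:E = 1)%E;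
  measurable_regression : measurable_fun (@unit_cube R d) regression;
  noise_variance_gt0 : 0 < noise_variance }.

Section laws.
Context (R : realType) (d : nat) (th : param R d).
Local Open Scope ereal_scope.
Local Notation cube := (@unit_cube R d).
Local Notation leb := (@lebesgue_rV R d).
Local Notation mcube := (@measurable_unit_cube R d).

(** law of X: the measure p(x) dx on the cube *)
Definition design_law (A : set 'rV[R]_d) : \bar R :=
  \int[leb]_(x in cube `&` A) (density th x)%:E.

Let design_law0 : design_law set0 = 0.
Proof. by rewrite /design_law setI0 integral_set0. Qed.

Let design_law_ge0 A : 0 <= design_law A.
Proof.
by apply: integral_ge0 => x [cx _]; rewrite lee_fin; exact: density_ge0.
Qed.

Let design_law_sigma_additive : semi_sigma_additive design_law.
Proof.
move=> F mF tF mUF.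
rewrite /design_law setI_bigcupr ge0_integral_bigcup//=.
- apply: is_cvg_nneseries => n _ _.
  by apply: integral_ge0 => x [cx _]; rewrite lee_fin; exact: density_ge0.
- by move=> k; apply: measurableI => //; exact: mcube.
- apply/measurable_EFinP; rewrite -setI_bigcupr.
  apply: (@measurable_funS _ _ _ _ cube) => //; first exact: mcube.
  exact: measurable_density.
- by move=> x [k _ [cx _]]; rewrite lee_fin; exact: density_ge0.
- exact: trivIset_setIl.
Qed.

HB.instance Definition _ := isMeasure.Build _ _ _ design_law
  design_law0 design_law_ge0 design_law_sigma_additive.

Let design_lawT : design_law setT = 1.
Proof. by rewrite /design_law setIT integral_density. Qed.

HB.instance Definition _ :=
  Measure_isProbability.Build _ _ _ design_law design_lawT.

(** law of (X, Y) = (X, f(X) + eps), where X has law p(x) dx and eps has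
    conditional law Q_x given X = x *)
Definition joint_law (A : set ('rV[R]_d * R)) : \bar R :=
  \int[design_law]_(x in cube)
    noise th x [set u | A (x, (regression th x + u)%R)].

Let measurable_section A x : measurable A ->
  measurable [set u | A (x, (regression th x + u)%R)].
Proof.
move=> mA; rewrite -[X in measurable X]setTI.
have mg : measurable_fun setT (fun u : R => (x, (regression th x + u)%R)).
  apply/measurable_fun_pairP; split => /=; first exact: measurable_cst.
  exact: measurable_funD.
exact: mg.
Qed.

Let measurable_joint A : measurable A ->
  measurable_fun cube
    (fun x => noise th x [set u | A (x, (regression th x + u)%R)]).
Proof.
move=> mA.
pose h (z : 'rV[R]_d * R) := (z.1, ((regression th \_ cube) z.1 + z.2)%R).
have mh : measurable_fun setT h.
  apply/measurable_fun_pairP; split => /=; first exact: measurable_fst.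
  have mr : measurable_fun setT (regression th \_ cube).
    apply: (measurable_restrictT _ _).1; first exact: mcube.
    exact: measurable_regression.
  by apply: measurable_funD => //=; exact: measurableT_comp.
have mhA : measurable (h @^-1` A).
  by rewrite -[X in measurable X]setTI; exact: mh.
have := @measurable_fun_xsection_finite_kernel _ _ _ _ R (noise th) (h @^-1` A).
rewrite inE => /(_ mhA) m1.
apply: (eq_measurable_fun (fun x => noise th x (xsection (h @^-1` A) x))).
  move=> x cx; congr (noise th x _).
  rewrite /xsection; apply/seteqP; split => u /=;
  by rewrite in_setE /h /= patchE cx.
apply: (measurable_funS _ _ m1) => //.
Qed.

Let joint_law0 : joint_law set0 = 0.
Proof. by rewrite /joint_law integral0_eq// => x _; rewrite measure0. Qed.

Let joint_law_ge0 A : 0 <= joint_law A.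
Proof. by apply: integral_ge0 => x _; exact: measure_ge0. Qed.

Let joint_law_sigma_additive : semi_sigma_additive joint_law.
Proof.
move=> F mF tF mUF.
rewrite [X in _ --> X](_ : _ = \sum_(n <oo) joint_law (F n)).
  by apply: is_cvg_nneseries => n _ _.
rewrite /joint_law -integral_nneseries//; last 2 first.
- exact: mcube.
- by move=> n; exact: measurable_joint.
apply: eq_integral => x _; apply/esym/cvg_lim => //=.
rewrite (_ : [set u | _] =
  \bigcup_n [set u | F n (x, (regression th x + u)%R)])//.
apply: measure_sigma_additive; first by move=> n; exact: measurable_section.
by move=> i j _ _ [u [Fi Fj]]; apply: tF => //; eexists; split; [exact: Fi|].
Qed.

HB.instance Definition _ := isMeasure.Build _ _ _ joint_law
  joint_law0 joint_law_ge0 joint_law_sigma_additive.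

Let joint_lawT : joint_law setT = 1.
Proof.
rewrite /joint_law (eq_integral (cst 1)).
  rewrite integral_cst ?mul1e; last exact: mcube.
  by transitivity (design_law setT) => //; rewrite /= /design_law setIid setIT.
by move=> x _; rewrite -[RHS](@prob_kernel _ _ _ _ _ (noise th) x).
Qed.

HB.instance Definition _ :=
  Measure_isProbability.Build _ _ _ joint_law joint_lawT.

(** law of an i.i.d. sample of size n *)
Definition sample_law n : {measure set (n.-tuple ('rV[R]_d * R)) -> \bar R} :=
  tuple_measure joint_law n.

End laws.

(** [L], [pm], [pp], [vm], [vp], [C4] are L_s, p_-, p_+, v_-, v_+, C_4. A
    measurable non-integrable function has an infinite integral in the library
    (with oo - oo = -oo), so the first-moment equation includes integrability. *)
Section risk.
Context (R : realType) (d : nat).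
Local Open Scope ereal_scope.

Definition model (s : R) (U : set 'rV[R]_d) (pm pp L vm vp C4 : R) :
    set (param R d) :=
  [set th | [/\
    \forall x \ae @lebesgue_rV R d, unit_cube x ->
      (pm <= density th x <= pp)%R,
    exists2 F, holder_ball s U L F & {in @unit_cube R d, F =1 regression th},
    \forall x \ae design_law th, unit_cube x -> [/\
      \int[noise th x]_u u%:E = 0,
      \int[noise th x]_u (u ^+ 2)%:E = (noise_variance th)%:E &
      \int[noise th x]_u (u ^+ 4)%:E <= C4%:E] &
    (vm <= noise_variance th <= vp)%R]].

Definition rmse n (th : param R d) (est : n.-tuple ('rV[R]_d * R) -> R) :
    \bar R :=
  (\int[sample_law th n]_z ((est z - noise_variance th) ^+ 2)%:E) `^ 2^-1.

Definition minimax_risk n (Theta : set (param R d)) : \bar R :=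
  ereal_inf [set ereal_sup [set rmse th est | th in Theta] |
    est in [set est : n.-tuple ('rV[R]_d * R) -> R | measurable_fun setT est]].

End risk.

(* Main.v *)
Require Import Defs.
From HB Require Import structures.
From mathcomp Require Import all_boot all_order all_algebra.
From mathcomp Require Import all_classical all_reals all_analysis.
From mathcomp Require Import measurable_realfun ess_sup_inf.
From mathcomp Require Import ring lra zify.
Import Order.TTheory GRing.Theory Num.Theory.
Import numFieldNormedType.Exports.
Set Implicit Arguments.
Unset Strict Implicit.
Unset Printing Implicit Defensive.
Local Open Scope classical_set_scope.
Local Open Scope ring_scope.

(** The variance of the noise is estimated at the parametric rate by the residual
    sum of squares of a piecewise polynomial regression, normalized by the trace of
    its quadratic form. The cube is cut into cells of side [1 / m] with [m ^ d] a
    small multiple of [n]: then the polynomials of the cells have at most [n / 2]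
    coefficients, which leaves at least [n / 2] degrees of freedom whatever the
    design points are.

    Let [A] be the matrix of the residual quadratic form, a function of the design
    only. Conditionally on the design, the form evaluated at the observations minus
    [V * \tr A] is the sum of the bias [f^T A f] and of a centered term
    ([quad_noise_decomposition]).
    - On a cell, [f] is within a multiple of [m ^ (- s)] of a polynomial with bounded
      coefficients ([holder_ball_taylor]), so the bias is of order
      [n * m ^ (- 2 s)], that is, of order [n ^ (1 - 2 s / d)], which is at most of
      order [sqrt n] exactly when [d <= 4 s] ([mesh_bias]).
    - The centered term is a sum of martingale differences for the order of the
      observations. It is a quadratic form in independent centered noises with
      bounded fourth moments, and the rows of [A] have norm at most 1, so its
      variance is of order [n] ([integral_mart_sqr]).
    Dividing by [\tr A >= n / 2] gives an error of order [n ^ (- 1 / 2)]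
    ([minimax_upper_bound]).

    Two choices keep this elementary. Least squares is replaced by ridge regression
    with a small penalty: the residual matrix is then a rational function of the
    features, hence a measurable function of the design, and the penalty adds
    little to the bias because the coefficients are bounded ([ridge_quad_le]). And
    every mean-zero claim is reduced to one criterion
    ([integral_sample_centered]): a statistic that, all the rest being frozen, is a
    combination of one noise and of its centered square integrates to zero.

    For the lower bound it is enough to let the law of the noise vary, with zero
    regression function and uniform design. Symmetric laws on four fixed points,
    two of square [vm] and two of slightly larger square, meet the moment
    constraints, and their variance is affine in one weight. Two such weights at
    distance of order [n ^ (- 1 / 2)] give samples whose likelihood ratio has second
    moment at most 2, and Le Cam's two-point method applies
    ([minimax_lower_bound]). *)

(** * Integration over products of measures on tuples *)

Section tuple_integral.
Context d (T : measurableType d) (R : realType).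
Local Open Scope ereal_scope.

(** The product of measures on tuples is built from the product that integrates
    over the first factor inside, whereas Tonelli's theorem is stated for the one
    that integrates over the second factor inside. *)
Lemma ge0_integral_prod2 d1 d2 (T1 : measurableType d1) (T2 : measurableType d2)
    (m1 : {sigma_finite_measure set T1 -> \bar R})
    (m2 : {sigma_finite_measure set T2 -> \bar R}) (f : T1 * T2 -> \bar R) :
  measurable_fun setT f -> (forall z, 0 <= f z) ->
  \int[m1 \x^ m2]_z f z = \int[m1 \x m2]_z f z.
Proof.
move=> mf f0; apply: eq_measure_integral => A mA _; apply/esym.
apply: (product_measure_unique (m' := (m1 \x^ m2))) => // B C mB mC.
exact: product_measure2E.
Qed.

Section box.
Variable mu : {sigma_finite_measure set T -> \bar R}.

Lemma tuple_measure_box n (S : 'I_n -> set T) :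
  (forall i, measurable (S i)) ->
  tuple_measure mu n [set t | forall i, S i (tnth t i)] = \prod_i mu (S i).
Proof.
elim: n S => [|n IH] S mS.
  rewrite big_ord0 /= diracE mem_set//= => -[]//.
rewrite big_ord_recl -IH//= /cons_measure/= /pushforward.
rewrite -product_measure2E//; last first.
  rewrite (_ : [set _ | _] = \bigcap_(i in [set: 'I_n])
     ((@tnth _ _ ^~ i) @^-1` S (lift ord0 i))).
    apply: fin_bigcap_measurable => // i _.
    by rewrite -[X in measurable X]setTI; exact: measurable_tnth.
  by apply/seteqP; split => x /= h i; [move=> _; exact: h|exact: h].
congr ((_ \x^ _) _); apply/seteqP; split => -[x t]/=.
  move=> h; split; first by have := h ord0; rewrite tnth0.
  by move=> i; have := h (lift ord0 i); rewrite tnthS.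
by move=> [h0 h] i; case: (unliftP ord0 i) => [j ->|->]; rewrite ?tnthS ?tnth0.
Qed.

End box.

Variable P : probability T R.

Lemma tuple_measureT n : tuple_measure P n setT = 1.
Proof.
have := @tuple_measure_box P n (fun=> setT) (fun=> measurableT).
rewrite big1; last by move=> i _; exact: probability_setT.
by move=> <-; congr (tuple_measure _ _ _); apply/seteqP; split.
Qed.

(** [tuple_measure] returns a bare measure; this copy carries the probability
    structure, hence the sigma-finiteness, that Tonelli's theorem asks for. *)
Definition tuple_prob n : set (n.-tuple T) -> \bar R := tuple_measure P n.

Arguments tuple_prob : clear implicits.

HB.instance Definition _ n := Measure.on (tuple_prob n).
HB.instance Definition _ n :=
  Measure_isProbability.Build _ _ _ (tuple_prob n) (tuple_measureT n).

Lemma ge0_integral_cons n (f : n.+1.-tuple T -> \bar R) :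
  measurable_fun setT f -> (forall t, 0 <= f t) ->
  \int[tuple_measure P n.+1]_t f t =
  \int[P \x (tuple_prob n)]_z f (Defs.cons_tuple z).
Proof.
move=> mf f0; rewrite /= /cons_measure ge0_integral_pushforward//=.
  rewrite preimage_setT; apply: (@ge0_integral_prod2 _ _ _ _ P (tuple_prob n)) => //=.
  by apply: measurableT_comp => //; exact: measurable_cons_tuple.
exact: measurable_cons_tuple.
Qed.

Let mcons n (f : n.+1.-tuple T -> \bar R) : measurable_fun setT f ->
  measurable_fun setT (f \o @Defs.cons_tuple _ T n).
Proof. by move=> mf; apply: measurableT_comp => //; exact: measurable_cons_tuple. Qed.

Lemma ge0_integral_tupleS n (f : n.+1.-tuple T -> \bar R) :
  measurable_fun setT f -> (forall t, 0 <= f t) ->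
  \int[tuple_measure P n.+1]_t f t =
  \int[P]_x \int[tuple_measure P n]_t f [tuple of x :: t].
Proof.
move=> mf f0; rewrite ge0_integral_cons//.
exact: (@fubini_tonelli1 _ _ _ _ _ P (tuple_prob n) _ (mcons mf) (fun z => f0 _)).
Qed.

Lemma ge0_integral_tupleS_sym n (f : n.+1.-tuple T -> \bar R) :
  measurable_fun setT f -> (forall t, 0 <= f t) ->
  \int[tuple_measure P n.+1]_t f t =
  \int[tuple_measure P n]_t \int[P]_x f [tuple of x :: t].
Proof.
move=> mf f0; rewrite ge0_integral_cons//.
exact: (@fubini_tonelli2 _ _ _ _ _ P (tuple_prob n) _ (mcons mf) (fun z => f0 _)).
Qed.

Lemma measurable_ge0_integral_tupleS n (f : n.+1.-tuple T -> \bar R) :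
  measurable_fun setT f -> (forall t, 0 <= f t) ->
  measurable_fun setT (fun x => \int[tuple_measure P n]_t f [tuple of x :: t]).
Proof.
move=> mf f0.
exact: (@measurable_fun_fubini_tonelli_F _ _ _ _ _ (tuple_prob n) _ (mcons mf) (fun z => f0 _)).
Qed.

Lemma measurable_cons_cst n (x : T) :
  measurable_fun setT (fun t : n.-tuple T => [tuple of x :: t]).
Proof. by apply: measurable_cons => //; exact: measurable_cst. Qed.

Definition tuple_upd n (t : n.-tuple T) (i : 'I_n) (x : T) : n.-tuple T :=
  [tuple if j == i then x else tnth t j | j < n].

(** Coordinates of a product measure can be integrated out in any order, so it
    suffices to compare the integrals over one coordinate, the others being
    frozen. *)
Lemma eq_ge0_integral_upd n (i : 'I_n) (f g : n.-tuple T -> \bar R) :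
  measurable_fun setT f -> measurable_fun setT g ->
  (forall t, 0 <= f t) -> (forall t, 0 <= g t) ->
  (forall t, \int[P]_x f (tuple_upd t i x) = \int[P]_x g (tuple_upd t i x)) ->
  \int[tuple_measure P n]_t f t = \int[tuple_measure P n]_t g t.
Proof.
elim: n i f g => [[]//|n IH i f g mf mg f0 g0 fg].
case: (unliftP ord0 i) fg => [j ->|->] fg.
  rewrite !ge0_integral_tupleS//; apply: eq_integral => x _.
  apply: (IH j) => //.
  - by apply: measurableT_comp => //; exact: measurable_cons_cst.
  - by apply: measurableT_comp => //; exact: measurable_cons_cst.
  - move=> t; have := fg [tuple of x :: t].
    have E y : tuple_upd [tuple of x :: t] (lift ord0 j) y = [tuple of x :: tuple_upd t j y].
      apply/eq_from_tnth => k; rewrite tnth_mktuple.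
      have [l ->|->] := unliftP ord0 k; last by rewrite !tnth0.
      by rewrite !tnthS tnth_mktuple (inj_eq lift_inj).
    under eq_integral do rewrite E.
    by under [in RHS]eq_integral do rewrite E.
rewrite !ge0_integral_tupleS_sym//; apply: eq_integral => t _.
have E y : tuple_upd [tuple of point :: t] ord0 y = [tuple of y :: t].
  apply/eq_from_tnth => k; rewrite tnth_mktuple.
  by have [l ->|->] := unliftP ord0 k; rewrite ?tnthS ?tnth0.
have := fg [tuple of point :: t].
under eq_integral do rewrite E.
by under [in RHS]eq_integral do rewrite E.
Qed.

Lemma ge0_integral_tnth n (i : 'I_n) (f : T -> \bar R) :
  measurable_fun setT f -> (forall x, 0 <= f x) ->
  \int[tuple_measure P n]_t f (tnth t i) = \int[P]_x f x.
Proof.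
move=> mf f0; transitivity (\int[tuple_measure P n]_t (cst (\int[P]_x f x) t)).
  apply: (@eq_ge0_integral_upd _ i) => //.
  - by apply: measurableT_comp => //; exact: measurable_tnth.
  - by move=> t; exact: integral_ge0.
  - move=> t; transitivity (\int[P]_x f x).
      by apply: eq_integral => x _; rewrite tnth_mktuple eqxx.
    by rewrite -[LHS]mule1 -(probability_setT P) -integral_cst.
by rewrite integral_cst// tuple_measureT mule1.
Qed.

End tuple_integral.
Arguments tuple_prob {d T R} P n.

(** * Disintegration of mixtures *)

Section mixture.
Context d1 d2 d3 (X : measurableType d1) (Y : measurableType d2)
  (Z : measurableType d3) (R : realType).
Variables (nu : {measure set X -> \bar R}) (D : set X) (mD : measurable D).
Variables (K : R.-pker X ~> Y) (g : X * Y -> Z).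
Hypothesis mg : measurable_fun setT g.
Local Open Scope ereal_scope.
Variable m : {measure set Z -> \bar R}.
Hypothesis mE : forall A, measurable A ->
  m A = \int[nu]_(x in D) K x [set u | A (g (x, u))].

Let mgx x : measurable_fun setT (fun u => g (x, u)).
Proof. by apply: measurableT_comp => //; exact: measurable_pair1. Qed.

Lemma measurable_mixture_integral (f : Z -> \bar R) :
  measurable_fun setT f -> (forall z, 0 <= f z) ->
  measurable_fun setT (fun x => \int[K x]_u f (g (x, u))).
Proof.
move=> mf f0.
apply: (measurable_fun_integral_finite_kernel (f \o g) K) => [z|].
  exact: f0.
exact: measurableT_comp.
Qed.

Import HBNNSimple.

Let mixture_indic A : measurable A ->
  \int[m]_z (\1_A z)%:E = \int[nu]_(x in D) \int[K x]_u (\1_A (g (x, u)))%:E.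
Proof.
move=> mA; rewrite integral_indic// setIT mE//.
apply: eq_integral => x _.
rewrite (_ : (fun u => _) = (fun u => (\1_[set u | A (g (x, u))] u)%:E)).
  rewrite integral_indic ?setIT//.
  by rewrite -[X in measurable X]setTI; exact: mgx.
by apply/funext => u; rewrite !indicE; congr ((nat_of_bool _)%:R%:E).
Qed.

Let mixture_nnsfun (f : {nnsfun Z >-> R}) :
  \int[m]_z (f z)%:E = \int[nu]_(x in D) \int[K x]_u (f (g (x, u)))%:E.
Proof.
have mi r : measurable_fun setT (fun z => (r * \1_(f @^-1` [set r]) z)%:E).
  apply/measurable_EFinP; apply: measurable_funM => //.
have i0 r z : 0 <= (r * \1_(f @^-1` [set r]) z)%:E.
  by rewrite EFinM nnfun_muleindic_ge0.
under [in LHS]eq_integral do rewrite fimfunE -fsumEFin//.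
rewrite ge0_integral_fsum//.
under [in RHS]eq_integral.
  move=> x _.
  under eq_integral do rewrite fimfunE -fsumEFin//.
  rewrite /= ge0_integral_fsum//; last first.
    by move=> r; exact: (measurableT_comp (mi r) (mgx x)).
  over.
rewrite /= ge0_integral_fsum//; last 2 first.
  - by move=> r; apply: measurable_funTS; exact: (measurable_mixture_integral (mi r) (i0 r)).
  - by move=> r x _; apply: integral_ge0 => u _; exact: i0.
apply: eq_fsbigr => r _.
have [r0|r0] := leP 0%R r; last first.
  rewrite !integral0_eq// => [x _|z _].
    by rewrite integral0_eq// => u _; rewrite preimage_nnfun0// indic0 mulr0.
  by rewrite preimage_nnfun0// indic0 mulr0.
under eq_integral do rewrite EFinM.
rewrite ge0_integralZl//.
rewrite mixture_indic// -ge0_integralZl//; last 2 first.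
  - apply: measurable_funTS; apply: (@measurable_mixture_integral (fun z => (\1_(f @^-1` [set r]) z)%:E)) => //.
    by apply/measurable_EFinP; exact: measurable_indic.
  - by move=> x _; apply: integral_ge0.
apply: eq_integral => x _; rewrite -ge0_integralZl//.
by apply/measurable_EFinP; apply: measurableT_comp (mgx x) => //; exact: measurable_indic.
by apply/measurable_EFinP; exact: measurable_indic.
Qed.

(** The formula that defines the mixture on sets extends to indicators, then to
    simple functions, then to nonnegative measurable functions by monotone
    convergence. *)
Lemma ge0_integral_mixture (f : Z -> \bar R) :
  measurable_fun setT f -> (forall z, 0 <= f z) ->
  \int[m]_z f z = \int[nu]_(x in D) \int[K x]_u f (g (x, u)).
Proof.
move=> mf f0.
pose f_ := nnsfun_approx measurableT mf.
have f_ge0 n z : 0 <= (f_ n z)%:E by rewrite lee_fin.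
have mf_ n : measurable_fun setT (fun z => (f_ n z)%:E) by exact/measurable_EFinP.
have ndf z a b : (a <= b)%N -> (f_ a z)%:E <= (f_ b z)%:E.
  by move=> ab; rewrite lee_fin; exact/lefP/nd_nnsfun_approx.
have fE z : f z = limn (fun n => (f_ n z)%:E).
  by apply/esym/cvg_lim => //=; exact: cvg_nnsfun_approx.
under eq_integral do rewrite fE.
rewrite monotone_convergence//; last by move=> z _ a b; exact: ndf.
under eq_fun do rewrite mixture_nnsfun.
rewrite -monotone_convergence//; last 3 first.
  - by move=> n; apply: measurable_funTS; exact: (measurable_mixture_integral (mf_ n) (f_ge0 n)).
  - by move=> n x _; apply: integral_ge0.
  - move=> x _ a b ab; apply: ge0_le_integral => //; try exact: (measurableT_comp (mf_ _) (mgx x)).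
    by move=> u _; exact: ndf.
apply: eq_integral => x _; rewrite -monotone_convergence//; last 2 first.
  - by move=> n; exact: (measurableT_comp (mf_ n) (mgx x)).
  - by move=> u _ a b; exact: ndf.
by apply: eq_integral => u _; rewrite fE.
Qed.

End mixture.

(** * Integrals under the law of the sample *)

Section centered.
Context (R : realType) (Q : probability R R) (V C4 : R).
Local Open Scope ereal_scope.
Hypotheses (Q1 : \int[Q]_u u%:E = 0) (Q2 : \int[Q]_u (u ^+ 2)%:E = V%:E).

Let int2 : Q.-integrable setT (fun u => (u ^+ 2)%:E).
Proof.
apply/integrableP; split; first by apply/measurable_EFinP; exact: measurable_funX.
under eq_integral do rewrite gee0_abs ?lee_fin ?sqr_ge0//.
by rewrite Q2 ltry.
Qed.

Let int1 : Q.-integrable setT (fun u => u%:E).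
Proof.
have i : Q.-integrable setT (fun u => (1 + u ^+ 2)%:E).
  under eq_fun do rewrite EFinD.
  by apply: integrableD => //; exact: finite_measure_integrable_cst.
apply: le_integrable i => //.
  by apply/measurable_EFinP; exact: measurable_id.
move=> u _; rewrite abse_EFin lee_fin [leRHS]ger0_norm ?addr_ge0 ?sqr_ge0//.
rewrite -real_normK ?num_real//; have := normr_ge0 u; move: `|u|%R => c c0.
have := sqr_ge0 (c - 1)%R; nra.
Qed.

(** Combinations of [u] and [u ^+ 2 - V] are centered. Equality of the integrals
    of the positive and negative parts is the form of this fact to which
    Tonelli's theorem applies. *)
Lemma centered_funepos_funeneg (a b : R) :
  let h := fun u => (a * u + b * (u ^+ 2 - V))%R in
  \int[Q]_u ((EFin \o h)^\+ u) = \int[Q]_u ((EFin \o h)^\- u).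
Proof.
move=> h.
have i1 : Q.-integrable setT (fun u => a%:E * u%:E) by exact: integrableZl.
have i2 : Q.-integrable setT (fun u => (u ^+ 2)%:E - V%:E).
  by apply: integrableB => //; exact: finite_measure_integrable_cst.
have i3 : Q.-integrable setT (fun u => b%:E * ((u ^+ 2)%:E - V%:E)) by exact: integrableZl.
have hE : EFin \o h = (fun u => a%:E * u%:E + b%:E * ((u ^+ 2)%:E - V%:E)).
  by apply/funext => u; rewrite /h/= EFinD EFinM [in X in _ + X]EFinM EFinB.
have ih : Q.-integrable setT (EFin \o h) by rewrite hE; exact: integrableD.
have h0 : \int[Q]_u (EFin \o h) u = 0.
  rewrite hE integralD// integralZl// Q1 mule0 add0e integralZl//.
  rewrite integralB//; last exact: finite_measure_integrable_cst.
  have -> : \int[Q]_u V%:E = V%:E.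
    by rewrite -[RHS]mule1 -(probability_setT Q) -integral_cst.
  by rewrite Q2 subee ?mule0.
move: h0; rewrite integralE => /eqP; rewrite sube_eq ?add0e; first by move/eqP.
- exact: integrable_pos_fin_num.
- by rewrite fin_num_adde_defl//; exact: integrable_neg_fin_num.
Qed.

End centered.

Section sample.
Context (R : realType) (d : nat) (th : param R d).
Local Open Scope ereal_scope.
Local Notation cube := (@unit_cube R d).
Local Notation V := (noise_variance th).

(** Outside the cube the regression function is arbitrary, possibly not
    measurable; extension by zero also makes it agree there with combinations of
    features supported by the cube. *)
Definition regression0 : 'rV[R]_d -> R := regression th \_ cube.

Lemma measurable_regression0 : measurable_fun setT regression0.
Proof.
apply: (measurable_restrictT _ _).1; first exact: measurable_unit_cube.
exact: measurable_regression.
Qed.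

Definition residual (z : 'rV[R]_d * R) : R := (z.2 - regression0 z.1)%R.

Lemma residualE x u : residual (x, (regression0 x + u)%R) = u.
Proof. by rewrite /residual/= addrC addKr. Qed.

Lemma measurable_residual : measurable_fun setT residual.
Proof.
apply: measurable_funB => //.
by apply: measurableT_comp => //; exact: measurable_regression0.
Qed.

Let g (z : 'rV[R]_d * R) := (z.1, (regression0 z.1 + z.2)%R).

Let mg : measurable_fun setT g.
Proof.
apply/measurable_fun_pairP; split => /=; first exact: measurable_fst.
apply: measurable_funD => //=; apply: measurableT_comp => //.
exact: measurable_regression0.
Qed.

Lemma ge0_integral_joint (f : 'rV[R]_d * R -> \bar R) :
  measurable_fun setT f -> (forall z, 0 <= f z) ->
  \int[joint_law th]_z f z = \int[design_law th]_(x in cube)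
     \int[noise th x]_u f (x, (regression0 x + u)%R).
Proof.
move=> mf f0.
have H (A : set ('rV[R]_d * R)) : measurable A -> joint_law th A =
    \int[design_law th]_(x in cube) noise th x [set u | A (g (x, u))].
  move=> mA /=; rewrite /joint_law; apply: eq_integral => x cx.
  by rewrite /g /= /regression0 patchE cx.
exact: (ge0_integral_mixture (@measurable_unit_cube R d) mg H mf f0).
Qed.

Lemma measurable_integral_noise (f : 'rV[R]_d * R -> \bar R) :
  measurable_fun setT f -> (forall z, 0 <= f z) ->
  measurable_fun cube (fun x => \int[noise th x]_u f (x, (regression0 x + u)%R)).
Proof.
move=> mf f0; apply: measurable_funTS.
exact: (measurable_mixture_integral _ mg).
Qed.

Lemma design_law_cube : design_law th cube = 1.
Proof. by rewrite /design_law setIid integral_density. Qed.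

Lemma measurable_tuple_upd d1 (T : measurableType d1) n (t : n.-tuple T) i :
  measurable_fun setT (tuple_upd t i).
Proof.
apply/measurable_fun_tnthP => j; rewrite /comp.
under eq_fun do rewrite tnth_mktuple.
by case: eqP => _; [exact: measurable_id|exact: measurable_cst].
Qed.

(** The values of a probability kernel are bare measures; this copy carries the
    probability structure. *)
Definition noise_prob (x : 'rV[R]_d) : set R -> \bar R := noise th x.
HB.instance Definition _ x := Measure.on (noise_prob x).
HB.instance Definition _ x := Measure_isProbability.Build _ _ _ (noise_prob x)
  (@prob_kernel _ _ _ _ _ (noise th) x).

Variables (C4 : R) (C4_ge0 : (0 <= C4)%R).
Hypothesis moments : \forall x \ae design_law th, unit_cube x -> [/\
      \int[noise th x]_u u%:E = 0,
      \int[noise th x]_u (u ^+ 2)%:E = V%:E &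
      \int[noise th x]_u (u ^+ 4)%:E <= C4%:E].

(** This is how the conditional moment assumption enters: given all the design
    points and all the other noises, a statistic that is a combination of the
    [i]-th noise and of its centered square has conditional mean zero. It is proved by comparing the
    integrals of the positive and negative parts, one coordinate at a time. *)
Lemma integral_sample_centered n (i : 'I_n) (f : n.-tuple ('rV[R]_d * R) -> R) :
  (sample_law th n).-integrable setT (EFin \o f) ->
  (forall t x, exists a b : R, forall u,
     f (tuple_upd t i (x, (regression0 x + u)%R)) = (a * u + b * (u ^+ 2 - V))%R) ->
  \int[sample_law th n]_t (f t)%:E = 0.
Proof.
move=> intf fab.
have mf : measurable_fun setT (EFin \o f) := measurable_int _ intf.
rewrite integralE.
suff -> : \int[sample_law th n]_t (EFin \o f)^\+ t = \int[sample_law th n]_t (EFin \o f)^\- t.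
  by rewrite subee//; exact: integrable_neg_fin_num.
apply: (@eq_ge0_integral_upd _ _ _ _ _ i) => //.
- exact: measurable_funepos.
- exact: measurable_funeneg.
move=> t.
have mP : measurable_fun setT (fun z => (EFin \o f)^\+ (tuple_upd t i z)).
  by apply: measurableT_comp; [exact: measurable_funepos|exact: measurable_tuple_upd].
have mN : measurable_fun setT (fun z => (EFin \o f)^\- (tuple_upd t i z)).
  by apply: measurableT_comp; [exact: measurable_funeneg|exact: measurable_tuple_upd].
rewrite !ge0_integral_joint//.
apply: ge0_ae_eq_integral => //.
- exact: measurable_unit_cube.
- exact: (measurable_integral_noise mP).
- exact: (measurable_integral_noise mN).
- by move=> x _; exact: integral_ge0.
- by move=> x _; exact: integral_ge0.
apply: filterS moments => x h /h[h1 h2 _].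
have [a [b fE]] := fab t x.
have := @centered_funepos_funeneg R (noise_prob x) V h1 h2 a b => /=.
rewrite (eq_integral (fun u => (EFin \o f)^\+ (tuple_upd t i (x, (regression0 x + u)%R)))).
  move=> ->; apply: eq_integral => u _.
  by rewrite !funeneg.unlock /= fE.
by move=> u _; rewrite !funepos.unlock /= fE.
Qed.

Lemma integral_residual4 n (i : 'I_n) :
  \int[sample_law th n]_t (residual (tnth t i) ^+ 4)%:E <= C4%:E.
Proof.
have r0 (x : R) : 0 <= (x ^+ 4)%:E by rewrite lee_fin exprn_even_ge0.
have mr : measurable_fun setT (fun z => (residual z ^+ 4)%:E).
  by apply/measurable_EFinP; apply: measurable_funX; exact: measurable_residual.
rewrite (@ge0_integral_tnth _ _ _ _ _ i (fun z => (residual z ^+ 4)%:E))//.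
rewrite ge0_integral_joint//.
rewrite -[leRHS]mule1 -design_law_cube -integral_cst; last exact: measurable_unit_cube.
apply: ae_ge0_le_integral => //.
- exact: measurable_unit_cube.
- by move=> x _; exact: integral_ge0.
- exact: (measurable_integral_noise mr).
- apply: filterS moments => x h /h[_ _ h4].
  by under eq_integral do rewrite residualE.
Qed.

End sample.

(** * The residual matrix of ridge regression *)

Section ridge.
Context (R : realFieldType) (n k : nat) (B : 'M[R]_(n, k)) (lam : R).
Hypothesis lam_gt0 : 0 < lam.

Definition ridge_gram : 'M[R]_k := lam%:M + B^T *m B.
(** The residual of the ridge regression of [f] on the columns of [B] with
    penalty [lam] is [ridge_residual_mx *m f]. For [lam] tending to 0 this tends
    to the orthogonal projection onto the complement of the range of [B], but,
    unlike that projection, it is a rational function of the entries of [B],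
    hence measurable in them. *)
Definition ridge_residual_mx : 'M[R]_n :=
  1%:M - B *m invmx ridge_gram *m B^T.
Local Notation G := ridge_gram.
Local Notation H := (invmx ridge_gram).
Local Notation A := ridge_residual_mx.

Definition dot m (u v : 'cV[R]_m) : R := (u^T *m v) 0 0.

Lemma dotE m (u v : 'cV[R]_m) : dot u v = \sum_i u i 0 * v i 0.
Proof. by rewrite /dot mxE; apply: eq_bigr => i _; rewrite mxE. Qed.

Lemma dotC m (u v : 'cV[R]_m) : dot u v = dot v u.
Proof. by rewrite !dotE; apply: eq_bigr => i _; rewrite mulrC. Qed.

Lemma dot_ge0 m (u : 'cV[R]_m) : 0 <= dot u u.
Proof. by rewrite dotE sumr_ge0// => i _; rewrite -expr2 sqr_ge0. Qed.

Lemma dotDl m (u v w : 'cV[R]_m) : dot (u + v) w = dot u w + dot v w.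
Proof. by rewrite /dot linearD/= mulmxDl mxE. Qed.

Lemma dotZr m a (u v : 'cV[R]_m) : dot u (a *: v) = a * dot u v.
Proof. by rewrite /dot -scalemxAr mxE. Qed.

Lemma dot_mull m p (M : 'M[R]_(m, p)) u v : dot (M *m u) v = dot u (M^T *m v).
Proof. by rewrite /dot trmx_mul mulmxA. Qed.

Lemma dot_young m (u v : 'cV[R]_m) : 2 * dot u v <= dot u u + dot v v.
Proof.
rewrite !dotE mulr_sumr -big_split/= ler_sum// => i _.
by have := sqr_ge0 (u i 0 - v i 0); nra.
Qed.

Lemma mxtrace_sqr_ge0 m p (M : 'M[R]_(m, p)) : 0 <= \tr (M^T *m M).
Proof.
rewrite /mxtrace sumr_ge0// => i _; rewrite mxE sumr_ge0// => j _.
by rewrite mxE -expr2 sqr_ge0.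
Qed.

(** A null vector [v] of the penalized Gram matrix satisfies
    [lam * |v|^2 + |B v|^2 = 0]. *)
Lemma ridge_gram_unit : G \in unitmx.
Proof.
rewrite -row_free_unit -kermx_eq0; apply/rowV0P => v /sub_kermxP vG0.
have : dot v^T (G *m v^T) = 0.
  by rewrite /dot trmxK mulmxA vG0 mul0mx mxE.
rewrite mulmxDl mul_scalar_mx dotC dotDl -mulmxA dot_mull trmxK dotC dotZr => h.
have [h1 h2] := (dot_ge0 v^T, dot_ge0 (B *m v^T)).
have : dot v^T v^T = 0.
  by apply/eqP; rewrite eq_le h1 andbT -(pmulr_rle0 _ lam_gt0); lra.
rewrite dotE => /eqP; rewrite psumr_eq0 => [/allP v0|i _]; last by rewrite -expr2 sqr_ge0.
apply/rowP => i; have := v0 i (mem_index_enum i).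
by rewrite !mxE mulf_eq0 orbb => /eqP.
Qed.

Lemma ridge_gram_sym : G^T = G.
Proof. by rewrite /ridge_gram linearD/= tr_scalar_mx trmx_mul trmxK. Qed.

Lemma ridge_gram_inv_sym : H^T = H.
Proof. by rewrite trmx_inv ridge_gram_sym. Qed.

Lemma ridge_residual_sym : A^T = A.
Proof.
by rewrite /ridge_residual_mx linearB/= trmx1 !trmx_mul trmxK ridge_gram_inv_sym mulmxA.
Qed.

(** With [G] the penalized Gram matrix, the trace of the fitted part is
    [\tr (G^-1 (G - lam)) = k - lam * \tr G^-1], and [\tr G^-1 >= 0] because
    [G^-1 = G^-1 G G^-1] is positive semidefinite. *)
Lemma mxtrace_ridge : n%:R - k%:R <= \tr A.
Proof.
rewrite /ridge_residual_mx linearB/= mxtrace1 lerD2l lerN2.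
rewrite mxtrace_mulC mulmxA mxtrace_mulC.
have -> : B^T *m B = G - lam%:M by rewrite /ridge_gram addrC addKr.
rewrite mulmxBr mulVmx ?ridge_gram_unit// mul_mx_scalar linearB/= mxtrace1.
rewrite mxtraceZ gerBl mulr_ge0 ?(ltW lam_gt0)//.
have -> : H = H^T *m G *m H by rewrite ridge_gram_inv_sym mulVmx ?ridge_gram_unit// mul1mx.
rewrite mulmxDr mulmxDl linearD/= mul_mx_scalar -scalemxAl mxtraceZ.
rewrite mulmxA -mulmxA -trmx_mul.
by rewrite addr_ge0 ?mxtrace_sqr_ge0// mulr_ge0 ?(ltW lam_gt0) ?mxtrace_sqr_ge0.
Qed.

Section fit.
Variable f : 'cV[R]_n.
Let w := A *m f.
Let t := H *m (B^T *m f).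

(* [w] is the residual and [t] the fitted coefficient vector; the normal
   equations say that [B^T w = lam t] *)
Let fE : f = w + B *m t.
Proof. by rewrite /w /t mulmxBl mul1mx !mulmxA subrK. Qed.

Let Bw : B^T *m w = lam *: t.
Proof.
have E : B^T *m f = G *m t by rewrite /t mulmxA mulmxV ?ridge_gram_unit// mul1mx.
have -> : w = f - B *m t by rewrite {1}fE addrK.
by rewrite mulmxBr E [B^T *m (B *m t)]mulmxA -mulmxBl {1}/ridge_gram addrK mul_scalar_mx.
Qed.

Let qE : dot f w = dot w w + lam * dot t t.
Proof. by rewrite {1}fE dotDl dot_mull Bw dotZr. Qed.

Lemma ridge_residual_norm : dot w w <= dot f w.
Proof. by rewrite qE lerDl mulr_ge0 ?dot_ge0// ltW. Qed.

Lemma ridge_residual_ge0 : 0 <= dot f w.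
Proof. exact: le_trans (dot_ge0 w) ridge_residual_norm. Qed.

(** The quadratic form of the residual matrix is the minimum of the penalized
    least squares criterion, so any [th] gives an upper bound. This is Young's
    inequality applied to [dot f w = dot (f - B *m th) w + lam * dot th t]. *)
Lemma ridge_residual_le (th : 'cV[R]_k) :
  dot f w <= dot (f - B *m th) (f - B *m th) + lam * dot th th.
Proof.
have E : dot f w = dot (f - B *m th) w + lam * dot th t.
  transitivity (dot (f - B *m th + B *m th) w); first by rewrite subrK.
  by rewrite dotDl [X in _ + X]dot_mull Bw dotZr.
have h1 := dot_young (f - B *m th) w.
have h2 : lam * (2 * dot th t) <= lam * (dot th th + dot t t).
  by rewrite ler_pM2l// dot_young.
by have := qE; lra.
Qed.
End fit.

Lemma ridge_residual_quad (f : 'I_n -> R) :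
  \sum_i \sum_j A i j * f i * f j = dot (\col_i f i) (A *m \col_i f i).
Proof.
rewrite dotE; apply: eq_bigr => i _; rewrite !mxE mulr_sumr.
by apply: eq_bigr => j _; rewrite !mxE mulrCA mulrA.
Qed.

(** Apply the bound on the squared residual to a basis vector, with zero
    coefficients as competitor. *)
Lemma ridge_row_sqr i : \sum_j A i j ^+ 2 <= 1.
Proof.
pose e : 'cV[R]_n := delta_mx i 0.
have we j : (A *m e) j 0 = A i j.
  rewrite -[A in RHS]ridge_residual_sym [RHS]mxE -[RHS]/(A j i) -colE mxE//.
have -> : \sum_j A i j ^+ 2 = dot (A *m e) (A *m e).
  by rewrite dotE; apply: eq_bigr => j _; rewrite we expr2.
apply: le_trans (ridge_residual_norm e) _.
apply: le_trans (ridge_residual_le e 0) _.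
rewrite mulmx0 subr0 /dot !mulmx0 !mxE mulr0 addr0 (bigD1 i)//= !mxE !eqxx mulr1.
by rewrite big1 ?addr0// => j ji; rewrite !mxE (negbTE ji) mul0r.
Qed.

Lemma ridge_quad_le (f : 'I_n -> R) (th : 'I_k -> R) :
  \sum_i \sum_j A i j * f i * f j <=
  \sum_i (f i - \sum_l B i l * th l) ^+ 2 + lam * \sum_l th l ^+ 2.
Proof.
rewrite ridge_residual_quad; apply: le_trans (ridge_residual_le _ (\col_l th l)) _.
rewrite !dotE; rewrite le_eqVlt; apply/orP; left; apply/eqP; congr (_ + _ * _); apply: eq_bigr => i _.
  rewrite !mxE expr2; congr (_ * _); congr (_ - _); apply: eq_bigr => l _; by rewrite mxE.
by rewrite !mxE expr2.
Qed.

Lemma ridge_quad_ge0 (f : 'I_n -> R) : 0 <= \sum_i \sum_j A i j * f i * f j.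
Proof. by rewrite ridge_residual_quad ridge_residual_ge0. Qed.

Lemma ridge_norm_le (f : 'I_n -> R) :
  \sum_i (\sum_j A i j * f j) ^+ 2 <= \sum_i \sum_j A i j * f i * f j.
Proof.
rewrite ridge_residual_quad; apply: le_trans _ (ridge_residual_norm _).
rewrite !dotE; rewrite le_eqVlt; apply/orP; left; apply/eqP; apply: eq_bigr => i _.
by rewrite expr2 !mxE; congr (_ * _); apply: eq_bigr => j _; rewrite !mxE.
Qed.

Lemma ridge_entryC i j : A i j = A j i.
Proof. by rewrite -[in RHS]ridge_residual_sym [RHS]mxE. Qed.

End ridge.

(** * Quadratic forms in the noise as sums of martingale differences *)

Section quadratic_noise_algebra.
Context (R : realFieldType) (n : nat).
Implicit Types (S : 'I_n -> 'I_n -> R).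

Lemma sum_sym_split S : (forall i j, S i j = S j i) ->
  \sum_i \sum_j S i j =
  \sum_i S i i + 2 * \sum_(i < n) \sum_(j < n | (j < i)%N) S i j.
Proof.
move=> Ssym.
have -> : \sum_i \sum_j S i j = \sum_i (S i i +
    (\sum_(j < n | (j < i)%N) S i j + \sum_(j < n | (i < j)%N) S i j)).
  apply: eq_bigr => i _; rewrite (bigD1 i)//=; congr (_ + _).
  rewrite (bigID (fun j : 'I_n => (j < i)%N))/=; congr (_ + _);
    apply: eq_bigl => j; rewrite -val_eqE/=; case: ltngtP => //.
rewrite !big_split/=; congr (_ + _).
have -> : \sum_(i < n) \sum_(j < n | (i < j)%N) S i j = \sum_(i < n) \sum_(j < n | (j < i)%N) S i j.
  rewrite (exchange_big_dep xpredT)//=; apply: eq_bigr => i _.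
  by apply: eq_bigr => j _; rewrite Ssym.
by rewrite mulr_natl mulr2n.
Qed.

Variables (A : 'I_n -> 'I_n -> R) (f e : 'I_n -> R) (V : R).
Hypothesis Asym : forall i j, A i j = A j i.
Hypothesis Arow : forall i, \sum_j A i j ^+ 2 <= 1.

Definition smoothed i := \sum_j A i j * f j.
Definition past (i : 'I_n) := \sum_(j < n | (j < i)%N) A i j * e j.
(** Ordering the indices turns the quadratic form in the noise into a sum of
    martingale differences: given the design, [mart_diff i] is centered in the
    [i]-th noise and involves otherwise only earlier noises. *)
Definition mart_diff i :=
  2 * (smoothed i + past i) * e i + A i i * (e i ^+ 2 - V).
Definition quad := \sum_i \sum_j A i j * f i * f j.

Local Notation w := smoothed.
Local Notation g := past.
Local Notation D := mart_diff.

Lemma quad_noise_decomposition :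
  \sum_i \sum_j A i j * (f i + e i) * (f j + e j) - V * \sum_i A i i =
  quad + \sum_i D i.
Proof.
have E1 : \sum_i \sum_j A i j * (f i + e i) * (f j + e j) =
    quad + (\sum_i \sum_j A i j * f i * e j + \sum_i \sum_j A i j * e i * f j)
         + \sum_i \sum_j A i j * e i * e j.
  rewrite /quad -!big_split/=; apply: eq_bigr => i _.
  by rewrite -!big_split/=; apply: eq_bigr => j _; ring.
have E2 : \sum_i \sum_j A i j * f i * e j = \sum_i w i * e i.
  rewrite exchange_big/=; apply: eq_bigr => i _; rewrite /smoothed mulr_suml.
  by apply: eq_bigr => j _; rewrite Asym.
have E3 : \sum_i \sum_j A i j * e i * f j = \sum_i w i * e i.
  apply: eq_bigr => i _; rewrite /smoothed mulr_suml.
  by apply: eq_bigr => j _; ring.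
have E4 : \sum_i \sum_j A i j * e i * e j =
    \sum_i A i i * e i ^+ 2 + 2 * \sum_i g i * e i.
  rewrite sum_sym_split; last by move=> i j; rewrite Asym; ring.
  congr (_ + 2 * _); first by apply: eq_bigr => i _; ring.
  apply: eq_bigr => i _; rewrite /past mulr_suml.
  by apply: eq_bigr => j _; ring.
rewrite E1 E2 E3 E4 -!addrA; congr (_ + _).
rewrite !mulr_sumr -sumrN -!big_split/=; apply: eq_bigr => i _.
by rewrite /mart_diff; ring.
Qed.

Lemma abs_entry_le1 i j : `|A i j| <= 1.
Proof.
rewrite -(@expr_le1 _ 2)// -normrX ger0_norm ?sqr_ge0//.
apply: le_trans (Arow i); rewrite (bigD1 j)//= lerDl.
by rewrite sumr_ge0// => l _; rewrite sqr_ge0.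
Qed.

(** The off-diagonal terms of [e i ^+ 2 * past i ^+ 2]; each contains some noise
    to the first power. *)
Definition cross_past (i : 'I_n) :=
  \sum_(j < n | (j < i)%N) \sum_(k < n | (k < i)%N && (k != j))
    A i j * A i k * e j * e k * e i ^+ 2.

Lemma past_sqr i : e i ^+ 2 * g i ^+ 2 =
  \sum_(j < n | (j < i)%N) A i j ^+ 2 * (e i ^+ 2 * e j ^+ 2) + cross_past i.
Proof.
rewrite /cross_past -big_split/= [g i ^+ 2]expr2 {1}/past mulr_suml mulr_sumr.
apply: eq_bigr => j ji; rewrite /past mulr_sumr mulr_sumr (bigD1 j)//=.
congr (_ + _); first by ring.
by apply: eq_bigr => k _; ring.
Qed.

Lemma sqr_mul_le (x y : R) : x ^+ 2 * y ^+ 2 <= 2^-1 * (x ^+ 4 + y ^+ 4).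
Proof.
have := sqr_ge0 (x ^+ 2 - y ^+ 2).
have -> : (x ^+ 2 - y ^+ 2) ^+ 2 = x ^+ 4 + y ^+ 4 - 2 * (x ^+ 2 * y ^+ 2) by ring.
lra.
Qed.

(** By [x^2 y^2 <= (x^4 + y^4) / 2] the fourth power of each noise is weighted by
    half a squared row norm and half a squared column norm of [A]. *)
Lemma sum_past_diag_le :
  \sum_(i < n) \sum_(j < n | (j < i)%N) A i j ^+ 2 * (e i ^+ 2 * e j ^+ 2) <=
  \sum_i e i ^+ 4.
Proof.
have e4 i : 0 <= e i ^+ 4 by rewrite exprn_even_ge0.
pose S i j := A i j ^+ 2 * (2^-1 * (e i ^+ 4 + e j ^+ 4)).
have S0 i j : 0 <= S i j.
  by rewrite mulr_ge0 ?sqr_ge0// mulr_ge0 ?invr_ge0// addr_ge0.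
apply: (@le_trans _ _ (\sum_i \sum_j S i j)).
  apply: ler_sum => i _; rewrite [leRHS](bigID (fun j : 'I_n => (j < i)%N))/=.
  rewrite -[leLHS]addr0 lerD ?sumr_ge0//.
  by apply: ler_sum => j _; rewrite ler_wpM2l ?sqr_ge0 ?sqr_mul_le.
have -> : \sum_i \sum_j S i j = \sum_i e i ^+ 4 * \sum_j A i j ^+ 2.
  transitivity (2^-1 * (\sum_i \sum_j A i j ^+ 2 * e i ^+ 4 +
                        \sum_i \sum_j A i j ^+ 2 * e j ^+ 4)).
    rewrite -big_split/= mulr_sumr; apply: eq_bigr => i _.
    by rewrite -big_split/= mulr_sumr; apply: eq_bigr => j _; rewrite /S; ring.
  rewrite [X in _ + X]exchange_big/=.
  have -> : \sum_j \sum_i A i j ^+ 2 * e j ^+ 4 = \sum_i \sum_j A i j ^+ 2 * e i ^+ 4.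
    by apply: eq_bigr => i _; apply: eq_bigr => j _; rewrite Asym.
  rewrite [LHS](_ : forall x : R, 2^-1 * (x + x) = x); last by move=> x; lra.
  apply: eq_bigr => i _; by rewrite mulr_sumr; apply: eq_bigr => j _; rewrite mulrC.
by apply: ler_sum => i _; rewrite -[leRHS]mulr1 ler_wpM2l.
Qed.

(** The terms of mean zero in the bound for the square of the sum of martingale
    differences. *)
Definition centered_part : R :=
  \sum_i \sum_(k < n | k != i) D i * D k
  + 12 * \sum_i w i ^+ 2 * (e i ^+ 2 - V) + 12 * \sum_i cross_past i.

(** The square of the sum is the sum of the squares plus products of distinct
    differences, which have mean zero. In the squares, replacing [e i ^+ 2] by
    its mean [V] and dropping cross products again costs only terms of mean zero;
    what is left is controlled by fourth moments since the rows of [A] have norm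
    at most 1. The constants come from [(x + y + z)^2 <= 3 (x^2 + y^2 + z^2)]. *)
Lemma mart_sqr_le (b : R) : 0 <= V -> \sum_i w i ^+ 2 <= b ->
  (\sum_i D i) ^+ 2 <=
  12 * V * b + 6 * n%:R * V ^+ 2 + 18 * (\sum_i e i ^+ 4) + centered_part.
Proof.
move=> V0 wb.
have -> : (\sum_i D i) ^+ 2 = \sum_i D i ^+ 2 + \sum_i \sum_(k < n | k != i) D i * D k.
  rewrite expr2 mulr_suml -big_split/=; apply: eq_bigr => i _.
  by rewrite mulr_sumr (bigD1 i)//= expr2.
have hD : \sum_i D i ^+ 2 <= \sum_i (12 * (w i ^+ 2 * e i ^+ 2)
    + 6 * (e i ^+ 4 + V ^+ 2) + 12 * (e i ^+ 2 * g i ^+ 2)).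
  apply: ler_sum => i _; rewrite /mart_diff.
  have a1 : A i i ^+ 2 <= 1.
    by rewrite -real_normK ?num_real// expr_le1// abs_entry_le1.
  have h3 (x y z : R) : (x + y + z) ^+ 2 <= 3 * (x ^+ 2 + y ^+ 2 + z ^+ 2).
    have := sqr_ge0 (x - y); have := sqr_ge0 (y - z); have := sqr_ge0 (x - z).
    by nra.
  have := h3 (2 * w i * e i) (2 * g i * e i) (A i i * (e i ^+ 2 - V)).
  have -> : 2 * w i * e i + 2 * g i * e i + A i i * (e i ^+ 2 - V) =
    2 * (w i + g i) * e i + A i i * (e i ^+ 2 - V) by ring.
  move=> /le_trans; apply.
  have h4 : (A i i * (e i ^+ 2 - V)) ^+ 2 <= 2 * (e i ^+ 4 + V ^+ 2).
    rewrite exprMn; apply: (@le_trans _ _ (1 * (e i ^+ 2 - V) ^+ 2)).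
      by rewrite ler_wpM2r ?sqr_ge0.
    have := sqr_ge0 (e i ^+ 2 + V).
    have -> : e i ^+ 4 = (e i ^+ 2) ^+ 2 by rewrite -exprM.
    nra.
  rewrite !exprMn; lra.
have hw : \sum_i (12 * (w i ^+ 2 * e i ^+ 2)) =
   12 * V * \sum_i w i ^+ 2 + 12 * \sum_i w i ^+ 2 * (e i ^+ 2 - V).
  by rewrite !mulr_sumr -big_split/=; apply: eq_bigr => i _; ring.
have hg : \sum_i (12 * (e i ^+ 2 * g i ^+ 2)) <=
    12 * \sum_i e i ^+ 4 + 12 * \sum_i cross_past i.
  rewrite -mulr_sumr -mulrDr ler_pM2l//.
  under eq_bigr do rewrite past_sqr.
  by rewrite big_split/= lerD2r sum_past_diag_le.
have he : \sum_(i < n) (6 * (e i ^+ 4 + V ^+ 2)) = 6 * (\sum_i e i ^+ 4) + 6 * n%:R * V ^+ 2.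
  rewrite -mulr_sumr big_split/= sumr_const card_ord -mulr_natl; ring.
have hb : 12 * V * \sum_i w i ^+ 2 <= 12 * V * b by rewrite ler_wpM2l// mulr_ge0.
move: hD; rewrite !big_split/= hw he /centered_part; lra.
Qed.

(** A dominating function: products of two martingale differences are bounded by
    a multiple of its square, which is integrable as soon as the noise has fourth
    moments. *)
Definition envelope : R := 1 + \sum_i e i ^+ 2.

Lemma envelope_ge1 : 1 <= envelope.
Proof. by rewrite lerDl sumr_ge0// => i _; rewrite sqr_ge0. Qed.

Lemma sqr_le_envelope i : e i ^+ 2 + 1 <= envelope.
Proof.
rewrite /envelope addrC lerD2l (bigD1 i)//= lerDl sumr_ge0// => j _.
by rewrite sqr_ge0.
Qed.

Lemma mul_le_envelope i j : `|e i * e j| <= envelope.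
Proof.
have := sqr_le_envelope i; have := sqr_le_envelope j.
have := sqr_ge0 (e i - e j); have := sqr_ge0 (e i + e j).
rewrite ler_norml => *; apply/andP; split; nra.
Qed.

Lemma abs_le_envelope i : `|e i| <= envelope.
Proof.
have := sqr_le_envelope i; have := sqr_ge0 (e i - 1); have := sqr_ge0 (e i + 1).
rewrite ler_norml => *; apply/andP; split; nra.
Qed.

Lemma envelope_sqr_le : envelope ^+ 2 <= 2 + 2 * n%:R * \sum_i e i ^+ 4.
Proof.
have h : (\sum_i e i ^+ 2) ^+ 2 <= n%:R * \sum_i e i ^+ 4.
  rewrite expr2 mulr_suml.
  apply: (@le_trans _ _ (\sum_i \sum_j 2^-1 * (e i ^+ 4 + e j ^+ 4))).
    apply: ler_sum => i _; rewrite mulr_sumr; apply: ler_sum => j _.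
    exact: sqr_mul_le.
  have cst (x : R) : \sum_(j < n) x = n%:R * x by rewrite sumr_const card_ord mulr_natl.
  under eq_bigr do rewrite -mulr_sumr big_split/= cst.
  by rewrite -mulr_sumr big_split/= cst -mulr_sumr; lra.
have := sqr_ge0 (1 - \sum_i e i ^+ 2); rewrite /envelope; nra.
Qed.

Lemma mart_diff_envelope (c : R) i : 0 <= V -> `|w i| <= c ->
  `|D i| <= (2 * c + 2 * n%:R + 1 + V) * envelope.
Proof.
move=> V0 wc.
have c0 : 0 <= c := le_trans (normr_ge0 _) wc.
have h1 : `|2 * w i * e i| <= 2 * c * envelope.
  by rewrite !normrM normr_nat ler_pM ?mulr_ge0// ?abs_le_envelope// ler_pM.
have h2 : `|2 * (g i * e i)| <= 2 * n%:R * envelope.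
  rewrite normrM normr_nat -mulrA ler_pM2l// /past mulr_suml.
  apply: (le_trans (ler_norm_sum _ _ _)).
  apply: (@le_trans _ _ (\sum_(j < n) envelope)); last by rewrite sumr_const card_ord mulr_natl.
  rewrite [leRHS](bigID (fun j : 'I_n => (j < i)%N))/= -[leLHS]addr0 lerD//.
    apply: ler_sum => j _; rewrite -mulrA normrM -[leRHS]mul1r.
    by rewrite ler_pM ?abs_entry_le1 ?mul_le_envelope.
  by rewrite sumr_ge0// => j _; exact: le_trans ler01 envelope_ge1.
have h3 : `|A i i * (e i ^+ 2 - V)| <= (1 + V) * envelope.
  rewrite normrM; apply: (@le_trans _ _ (1 * (e i ^+ 2 + V))).
    rewrite ler_pM// ?abs_entry_le1//; apply: le_trans (ler_normB _ _) _.
    by rewrite !ger0_norm ?sqr_ge0.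
  have := sqr_le_envelope i; have := envelope_ge1; nra.
have -> : D i = 2 * w i * e i + 2 * (g i * e i) + A i i * (e i ^+ 2 - V).
  by rewrite /mart_diff; ring.
apply: le_trans (ler_normD _ _) _; have := ler_normD (2 * w i * e i) (2 * (g i * e i)).
lra.
Qed.

End quadratic_noise_algebra.

(** * Mean squared error of quadratic estimators of the variance *)

Lemma measurable_funV d (T : measurableType d) (R : realType) (h : T -> R) :
  measurable_fun setT h -> (forall x, h x != 0) ->
  measurable_fun setT (fun x => (h x)^-1).
Proof.
move=> mh h0; apply: (@measurable_comp _ _ _ _ _ _ [set r : R | r != 0]) mh => //.
- exact: open_measurable.
- by move=> _ [x _ <-]; exact: h0.
- apply: open_continuous_measurable_fun => //; apply/in_setP => x /= x0.
  exact: inv_continuous.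
Qed.

Section sample_moments.
Context (R : realType) (d n : nat) (th : param R d).
Local Notation V := (noise_variance th).
Variables (C4 : R) (C4_ge0 : 0 <= C4).
Hypothesis moments : \forall x \ae design_law th, unit_cube x -> [/\
      (\int[noise th x]_u u%:E = 0)%E,
      (\int[noise th x]_u (u ^+ 2)%:E = V%:E)%E &
      (\int[noise th x]_u (u ^+ 4)%:E <= C4%:E)%E].

Let X (z : n.-tuple ('rV[R]_d * R)) (i : 'I_n) := (tnth z i).1.
Let e (z : n.-tuple ('rV[R]_d * R)) (i : 'I_n) := residual th (tnth z i).

Let me i : measurable_fun setT (fun z => e z i).
Proof. by apply: measurableT_comp; [exact: measurable_residual|exact: measurable_tnth]. Qed.

Let P := tuple_prob (joint_law th) n.

Lemma integrable_residual4 i : P.-integrable setT (fun z => (e z i ^+ 4)%:E).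
Proof.
apply/integrableP; split; first by apply/measurable_EFinP; exact: measurable_funX.
under eq_integral do rewrite gee0_abs ?lee_fin ?exprn_even_ge0//.
exact: le_lt_trans (integral_residual4 C4_ge0 moments i) (ltry _).
Qed.

Lemma integrable_sum_residual4 (a b : R) :
  P.-integrable setT (fun z => (a + b * \sum_i e z i ^+ 4)%:E).
Proof.
under eq_fun do rewrite EFinD EFinM -sumEFin.
apply: integrableD => //; first exact: finite_measure_integrable_cst.
apply: integrableZl => //; apply: integrable_sum => // i _.
exact: integrable_residual4.
Qed.

Lemma integral_sum_residual4 (a b : R) : 0 <= a -> 0 <= b ->
  (\int[P]_z (a + b * \sum_i e z i ^+ 4)%:E <= (a + b * (n%:R * C4))%:E)%E.
Proof.
move=> a0 b0.
have e0 z i : (0 <= (e z i ^+ 4)%:E)%E by rewrite lee_fin exprn_even_ge0.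
have me4 i : measurable_fun setT (fun z => (e z i ^+ 4)%:E).
  by apply/measurable_EFinP; exact: measurable_funX.
under eq_integral do rewrite EFinD EFinM -sumEFin.
rewrite integralD//=; last 2 first.
- exact: finite_measure_integrable_cst.
- apply: integrableZl => //; apply: integrable_sum => // i _.
  exact: integrable_residual4.
rewrite integralZl//; last by apply: integrable_sum => // i _; exact: integrable_residual4.
rewrite EFinD leeD//.
  by rewrite -[leRHS]mule1 -(probability_setT P) -integral_cst.
rewrite EFinM lee_wpmul2l ?lee_fin// integral_sum//; last first.
  by move=> i; exact: integrable_residual4.
apply: (@le_trans _ _ (\sum_(i < n) C4%:E)%E).
  by apply: lee_sum => i _; exact: integral_residual4.
by rewrite sumEFin sumr_const card_ord mulr_natl.
Qed.

Definition centered_stat (h : n.-tuple ('rV[R]_d * R) -> R) :=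
  P.-integrable setT (EFin \o h) /\ (\int[P]_z (h z)%:E = 0)%E.

Lemma centered_statD h k : centered_stat h -> centered_stat k -> centered_stat (fun z => h z + k z).
Proof.
move=> [ih h0] [ik k0]; split.
  by rewrite (_ : EFin \o _ = (EFin \o h) \+ (EFin \o k))%E//; exact: integrableD.
under eq_integral do rewrite EFinD.
by rewrite integralD//= h0 k0 adde0.
Qed.

Lemma centered_statZ a h : centered_stat h -> centered_stat (fun z => a * h z).
Proof.
move=> [ih h0]; split.
  by rewrite (_ : EFin \o _ = fun z => (a%:E * (EFin \o h) z)%E)//; exact: integrableZl.
under eq_integral do rewrite EFinM.
by rewrite integralZl//= h0 mule0.
Qed.

Lemma centered_stat_sum (I : Type) (r : seq I) (Q : pred I) (h : I -> _ -> R) :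
  (forall i, Q i -> centered_stat (h i)) -> centered_stat (fun z => \sum_(i <- r | Q i) h i z).
Proof.
move=> hn; elim: r => [|i r IH].
  under [X in centered_stat X]eq_fun do rewrite big_nil.
  by split; [exact: finite_measure_integrable_cst|exact: integral0].
under [X in centered_stat X]eq_fun do rewrite big_cons.
case: (boolP (Q i)) => // Qi; apply: centered_statD => //; exact: hn.
Qed.

(** The criterion used for every mean-zero term: domination by the envelope, and
    dependence on some noise [u i] only through [u i] and [u i ^+ 2 - V]. *)
Lemma centered_stat_coord (i : 'I_n)
    (h : ('I_n -> 'rV[R]_d) -> ('I_n -> R) -> R) (c : R) :
  measurable_fun setT (fun z => h (X z) (e z)) ->
  (forall x u, `|h x u| <= c * envelope u ^+ 2) ->
  (forall x u, exists a b, forall v,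
     h x (fun j => if j == i then v else u j) = a * v + b * (v ^+ 2 - V)) ->
  centered_stat (fun z => h (X z) (e z)).
Proof.
move=> mh hc hab.
have c0 : 0 <= c.
  have := le_trans (normr_ge0 _) (hc (fun=> 0) (fun=> 0)).
  rewrite pmulr_lge0// exprn_gt0// (lt_le_trans ltr01)//; exact: envelope_ge1.
have ih : P.-integrable setT (EFin \o (fun z => h (X z) (e z))).
  apply: le_integrable (integrable_sum_residual4 (c * 2) (c * (2 * n%:R))) => //.
    exact/measurable_EFinP.
  move=> z _; rewrite /= lee_fin [leRHS]ger0_norm.
    by apply: le_trans (hc _ _) _; rewrite -mulrA -mulrDr ler_wpM2l// envelope_sqr_le.
  by rewrite addr_ge0 ?mulr_ge0// sumr_ge0// => j _; rewrite exprn_even_ge0.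
split => //; apply: (integral_sample_centered moments (i := i)) => // t x.
pose x' j := if j == i then x else (tnth t j).1.
have [a [b ab]] := hab x' (e t); exists a, b => u; rewrite -ab; congr (h _ _).
  by apply/funext => j; rewrite /X /x' tnth_mktuple; case: ifP.
apply/funext => j; rewrite /e tnth_mktuple; case: ifP => // _.
by rewrite residualE.
Qed.

Variable A : ('I_n -> 'rV[R]_d) -> 'I_n -> 'I_n -> R.
Hypothesis Asym : forall x i j, A x i j = A x j i.
Hypothesis Arow : forall x i, \sum_j A x i j ^+ 2 <= 1.
Hypothesis mA : forall i j, measurable_fun setT (fun z => A (X z) i j).

Let f x (i : 'I_n) := regression0 th (x i).
Let w (x : 'I_n -> 'rV[R]_d) := smoothed (A x) (f x).
Let D (x : 'I_n -> 'rV[R]_d) u := mart_diff (A x) (f x) u V.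

Variable b : R.
Hypothesis wb : forall x, \sum_i w x i ^+ 2 <= b.

Let b0 : 0 <= b.
Proof. by apply: le_trans (wb (fun=> 0)); rewrite sumr_ge0// => i _; rewrite sqr_ge0. Qed.

Let V0 : 0 <= V. Proof. exact/ltW/noise_variance_gt0. Qed.

Let mw i : measurable_fun setT (fun z => w (X z) i).
Proof.
apply: measurable_sum => j; apply: measurable_funM => //.
apply: measurableT_comp; first exact: measurable_regression0.
by apply: measurableT_comp => //; exact: measurable_tnth.
Qed.

Let mpast (i : 'I_n) : measurable_fun setT (fun z => past (A (X z)) (e z) i).
Proof.
rewrite (_ : (fun _ => _) =
    fun z => \sum_(j < n) if (j < i)%N then A (X z) i j * e z j else 0).
  by apply: measurable_sum => j; case: (j < i)%N => //; exact: measurable_funM.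
by apply/funext => z; rewrite /past big_mkcond.
Qed.

Let mD i : measurable_fun setT (fun z => D (X z) (e z) i).
Proof.
apply: measurable_funD; last first.
  by apply: measurable_funM => //; apply: measurable_funB => //; exact: measurable_funX.
apply: measurable_funM => //; apply: measurable_funM => //; apply: measurable_funD => //.
exact: mw.
Qed.

Let wi_le x i : `|w x i| <= b + 1.
Proof.
have : w x i ^+ 2 <= b.
  apply: le_trans (wb x); rewrite (bigD1 i)//= lerDl sumr_ge0// => j _.
  by rewrite sqr_ge0.
rewrite -real_normK ?num_real//; have := normr_ge0 (w x i); nra.
Qed.

Let cD := 2 * (b + 1) + 2 * n%:R + 1 + V.

Let D_le x u i : `|D x u i| <= cD * envelope u.
Proof. exact: (mart_diff_envelope u (Arow x) V0 (wi_le x i)). Qed.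

Let env_sqr (u : 'I_n -> R) : envelope u <= envelope u ^+ 2 :> R.
Proof. by have := @envelope_ge1 R n u; nra. Qed.

Let past_upd x u (i k : 'I_n) v : (k <= i)%N ->
  past (A x) (fun j => if j == i then v else u j) k = past (A x) u k.
Proof.
move=> ki; apply: eq_bigr => j jk; rewrite ifF//.
by apply/negbTE; rewrite -val_eqE/= neq_ltn (leq_trans jk).
Qed.

(** The later of two martingale differences is centered in its own noise, of
    which the earlier one is independent. *)
Let centered_DD_lt (i k : 'I_n) : (k < i)%N ->
  centered_stat (fun z => D (X z) (e z) i * D (X z) (e z) k).
Proof.
move=> ki; apply: (@centered_stat_coord i (fun x u => D x u i * D x u k) (cD ^+ 2)).
- exact: measurable_funM.
- by move=> x u; rewrite normrM -exprMn expr2 ler_pM.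
move=> x u; exists (2 * (w x i + past (A x) u i) * D x u k), (A x i i * D x u k) => v.
have ki' : (k == i) = false by apply/negbTE; rewrite -val_eqE/= neq_ltn ki.
rewrite /D /mart_diff /w !past_upd ?(ltnW ki)// eqxx ki'. by rewrite mulrDl mulrAC; congr (_ + _); rewrite mulrAC.
Qed.

Let centered_DD (i k : 'I_n) : k != i ->
  centered_stat (fun z => D (X z) (e z) i * D (X z) (e z) k).
Proof.
rewrite -val_eqE/= neq_ltn => /orP[|ik]; first exact: centered_DD_lt.
by under [X in centered_stat X]eq_fun do rewrite mulrC; exact: centered_DD_lt.
Qed.

Let centered_w (i : 'I_n) : centered_stat (fun z => w (X z) i ^+ 2 * (e z i ^+ 2 - V)).
Proof.
apply: (@centered_stat_coord i (fun x u => w x i ^+ 2 * (u i ^+ 2 - V)) (b * (1 + V))).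
- by apply: measurable_funM; [exact: measurable_funX|apply: measurable_funB => //; exact: measurable_funX].
- move=> x u; rewrite normrM -mulrA ler_pM//.
    rewrite ger0_norm ?sqr_ge0//; apply: le_trans (wb x).
    by rewrite (bigD1 i)//= lerDl sumr_ge0// => j _; rewrite sqr_ge0.
  apply: le_trans (ler_normB _ _) _; rewrite !ger0_norm ?sqr_ge0//.
  have := sqr_le_envelope u i; have := env_sqr u; have := @envelope_ge1 R n u.
  have := V0; nra.
- by move=> x u; exists 0, (w x i ^+ 2) => v; rewrite eqxx mul0r add0r.
Qed.

Let centered_cross_term (i j k : 'I_n) : (k < i)%N -> k != j ->
  centered_stat (fun z => A (X z) i j * A (X z) i k * e z j * e z k * e z i ^+ 2).
Proof.
move=> ki kj.
apply: (@centered_stat_coord k (fun x u => A x i j * A x i k * u j * u k * u i ^+ 2) 1).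
- apply: measurable_funM; last exact: measurable_funX.
  by do 3 (apply: measurable_funM => //).
- move=> x u.
  have -> : A x i j * A x i k * u j * u k * u i ^+ 2 =
    (A x i j * A x i k) * ((u j * u i) * (u k * u i)) by ring.
  rewrite normrM ler_pM//.
    by rewrite normrM mulr_ile1 ?(abs_entry_le1 (Arow x)).
  by rewrite normrM expr2 ler_pM// mul_le_envelope.
- move=> x u; exists (A x i j * A x i k * u j * u i ^+ 2), 0 => v.
  have ik : (i == k) = false by apply/negbTE; rewrite -val_eqE/= neq_ltn ki orbT.
  by rewrite eqxx (eq_sym j) (negbTE kj) ik; ring.
Qed.

Let centered_cross (i : 'I_n) : centered_stat (fun z => cross_past (A (X z)) (e z) i).
Proof.
apply: centered_stat_sum => j _; apply: centered_stat_sum => k /andP[ki kj].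
exact: centered_cross_term.
Qed.

Lemma centered_stat_part :
  centered_stat (fun z => centered_part (A (X z)) (f (X z)) (e z) V).
Proof.
apply: centered_statD; first apply: centered_statD.
- by apply: centered_stat_sum => i _; apply: centered_stat_sum => k; exact: centered_DD.
- by apply: centered_statZ; apply: centered_stat_sum => i _; exact: centered_w.
- by apply: centered_statZ; apply: centered_stat_sum => i _; exact: centered_cross.
Qed.

Lemma measurable_mart_sum : measurable_fun setT (fun z => \sum_i D (X z) (e z) i).
Proof. exact: measurable_sum. Qed.

Lemma integral_mart_sqr : (\int[P]_z ((\sum_i D (X z) (e z) i) ^+ 2)%:E <=
  (12 * V * b + 6 * n%:R * V ^+ 2 + 18 * (n%:R * C4))%:E)%E.
Proof.
pose g z := 12 * V * b + 6 * n%:R * V ^+ 2 + 18 * (\sum_i e z i ^+ 4).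
pose N z := centered_part (A (X z)) (f (X z)) (e z) V.
have [iN N0] := centered_stat_part.
have ig : P.-integrable setT (fun z => (g z)%:E) by exact: integrable_sum_residual4.
have le_gN z : (\sum_i D (X z) (e z) i) ^+ 2 <= g z + N z.
  by apply: mart_sqr_le; [exact: Asym|exact: Arow|exact: V0|exact: wb].
apply: (@le_trans _ _ (\int[P]_z ((g z)%:E + (N z)%:E))%E).
  apply: ge0_le_integral => //.
  - by move=> z _; rewrite lee_fin sqr_ge0.
  - by apply/measurable_EFinP; apply: measurable_funX; exact: measurable_mart_sum.
  - by apply: emeasurable_funD; [exact: measurable_int ig|exact: measurable_int iN].
  - by move=> z _; rewrite -EFinD lee_fin.
rewrite integralD//= N0 adde0; apply: integral_sum_residual4 => //.
by rewrite addr_ge0 ?mulr_ge0 ?sqr_ge0.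
Qed.

Variable tau : R.
Hypothesis tau_gt0 : 0 < tau.
Hypothesis trA : forall x, tau <= \sum_i A x i i.
Hypothesis quad_ge0 : forall x, 0 <= quad (A x) (f x).
Hypothesis quad_le : forall x, quad (A x) (f x) <= b.

(** Normalizing by the trace makes the estimator unbiased up to the quadratic
    form of [A] in the regression function, since [V] times the trace is the
    conditional mean of the quadratic form of [A] in the noise. *)
Definition quad_estimator (z : n.-tuple ('rV[R]_d * R)) : R :=
  (\sum_i \sum_j A (X z) i j * (tnth z i).2 * (tnth z j).2) / \sum_i A (X z) i i.

Lemma quad_estimator_error z : quad_estimator z - V =
  (quad (A (X z)) (f (X z)) + \sum_i D (X z) (e z) i) / \sum_i A (X z) i i.
Proof.
have tr0 : \sum_i A (X z) i i != 0 by rewrite gt_eqF// (lt_le_trans tau_gt0).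
rewrite -quad_noise_decomposition// mulrBl mulfK// /quad_estimator.
congr (_ / _ - _); apply: eq_bigr => i _; apply: eq_bigr => j _.
by rewrite /f /e /residual ![regression0 _ _ + _]addrC !subrK.
Qed.

Let trA_neq0 x : \sum_i A x i i != 0.
Proof. by rewrite gt_eqF// (lt_le_trans tau_gt0). Qed.

Lemma measurable_quad_estimator : measurable_fun setT quad_estimator.
Proof.
have mY i : measurable_fun setT (fun z : n.-tuple ('rV[R]_d * R) => (tnth z i).2).
  by apply: measurableT_comp => //; exact: measurable_tnth.
apply: measurable_funM.
  apply: measurable_sum => i; apply: measurable_sum => j.
  by apply: measurable_funM => //; apply: measurable_funM.
apply: measurable_funV => [|z]; last exact: trA_neq0.
exact: measurable_sum.
Qed.

Lemma quad_estimator_mse :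
  (\int[P]_z ((quad_estimator z - V) ^+ 2)%:E <=
   ((tau ^- 2) * (2 * b ^+ 2 +
     2 * (12 * V * b + 6 * n%:R * V ^+ 2 + 18 * (n%:R * C4))))%:E)%E.
Proof.
have mM := measurable_mart_sum.
pose M z := \sum_i D (X z) (e z) i.
have t0 : 0 <= tau ^- 2 by rewrite invr_ge0 sqr_ge0.
have mM2 : measurable_fun setT (fun z => (M z ^+ 2)%:E).
  by apply/measurable_EFinP; exact: measurable_funX.
apply: (@le_trans _ _ (\int[P]_z ((tau ^- 2)%:E *
    ((2 * b ^+ 2)%:E + 2%:E * (M z ^+ 2)%:E)))%E).
  apply: ge0_le_integral => //.
  - by move=> z _; rewrite lee_fin sqr_ge0.
  - apply/measurable_EFinP; apply: measurable_funX; apply: measurable_funB => //.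
    exact: measurable_quad_estimator.
  - by apply: measurable_funeM; apply: emeasurable_funD => //; exact: measurable_funeM.
  - move=> z _; rewrite [leRHS](_ : _ = (tau ^- 2 * (2 * b ^+ 2 + 2 * M z ^+ 2))%:E)//.
    rewrite lee_fin quad_estimator_error.
    rewrite expr_div_n mulrC ler_pM ?invr_ge0 ?sqr_ge0//.
      by rewrite lef_pV2 ?posrE ?exprn_gt0// ?(lt_le_trans tau_gt0)// lerXn2r// nnegrE
        ?(ltW tau_gt0)// (le_trans (ltW tau_gt0)).
    rewrite -/(M z); have := quad_ge0 (X z); have := quad_le (X z).
    by have := sqr_ge0 (quad (A (X z)) (f (X z)) - M z); nra.
have M0 z : (0 <= (M z ^+ 2)%:E)%E by rewrite lee_fin sqr_ge0.
rewrite ge0_integralZl//; last 2 first.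
- by apply: emeasurable_funD => //; exact: measurable_funeM.
- by move=> z _; rewrite adde_ge0 ?mule_ge0// lee_fin mulr_ge0 ?sqr_ge0.
rewrite [leRHS]EFinM lee_wpmul2l ?lee_fin//.
rewrite ge0_integralD//; last 3 first.
- by move=> z _; rewrite lee_fin mulr_ge0 ?sqr_ge0.
- by move=> z _; rewrite mule_ge0.
- exact: measurable_funeM.
rewrite ge0_integralZl// [leRHS]EFinD leeD//.
  by rewrite -[leRHS]mule1 -(probability_setT P) -integral_cst.
by rewrite [leRHS]EFinM lee_wpmul2l//; exact: integral_mart_sqr.
Qed.

End sample_moments.

(** * Piecewise polynomial features on a grid *)

Section measurable_matrix.
Context d (T : measurableType d) (R : realType).

Definition measurable_entries p q (M : T -> 'M[R]_(p, q)) :=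
  forall i j, measurable_fun setT (fun t => M t i j).

Lemma measurable_entries_mul p q r (M : T -> 'M[R]_(p, q)) (N : T -> 'M[R]_(q, r)) :
  measurable_entries M -> measurable_entries N ->
  measurable_entries (fun t => M t *m N t).
Proof.
move=> mM mN i j; under eq_fun do rewrite mxE.
by apply: measurable_sum => k; exact: measurable_funM.
Qed.

Lemma measurable_entries_tr p q (M : T -> 'M[R]_(p, q)) :
  measurable_entries M -> measurable_entries (fun t => (M t)^T).
Proof. by move=> mM i j; under eq_fun do rewrite mxE; exact: mM. Qed.

Lemma measurable_entries_det p (M : T -> 'M[R]_p) :
  measurable_entries M -> measurable_fun setT (fun t => \det (M t)).
Proof.
move=> mM; apply: measurable_sum => s; apply: measurable_funM => //.
by apply: measurable_prod => i _; exact: mM.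
Qed.

(** Cramer's rule. *)
Lemma measurable_entries_inv p (M : T -> 'M[R]_p) :
  (forall t, M t \in unitmx) ->
  measurable_entries M -> measurable_entries (fun t => invmx (M t)).
Proof.
move=> Mu mM i j; rewrite (_ : (fun _ => _) =
    fun t => (\det (M t))^-1 * ((-1) ^+ (j + i) * \det (row' j (col' i (M t))))).
  apply: measurable_funM.
    apply: measurable_funV; first exact: measurable_entries_det.
    by move=> t; rewrite -unitfE -unitmxE.
  apply: measurable_funM => //; apply: measurable_entries_det => a b.
  by under eq_fun do rewrite !mxE; exact: mM.
by apply/funext => t; rewrite /invmx Mu !mxE.
Qed.

Lemma measurable_ridge_residual n k (B : T -> 'M[R]_(n, k)) (lam : R) :
  0 < lam -> measurable_entries B ->
  measurable_entries (fun t => ridge_residual_mx (B t) lam).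
Proof.
move=> lam0 mB.
have mG : measurable_entries (fun t => ridge_gram (B t) lam).
  move=> i j; under eq_fun do rewrite mxE.
  apply: measurable_funD; first exact: measurable_cst.
  by apply: measurable_entries_mul => //; exact: measurable_entries_tr.
have mBH : measurable_entries (fun t => B t *m invmx (ridge_gram (B t) lam) *m (B t)^T).
  apply: measurable_entries_mul; last exact: measurable_entries_tr.
  apply: measurable_entries_mul => //; apply: measurable_entries_inv => // t.
  exact: ridge_gram_unit.
move=> i j; under eq_fun do rewrite mxE [X in _ + X]mxE.
by apply: measurable_funB => //; exact: mBH.
Qed.

End measurable_matrix.

Section grid.
Context (R : realType) (d l m : nat).
Hypothesis m_gt0 : (0 < m)%N.

(** Half-open intervals partition the unit interval exactly; the price is a last
    one, of index [m], reduced to the endpoint 1. *)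
Definition grid_interval (j : nat) : set R :=
  `[j%:R / m%:R, j.+1%:R / m%:R[ `&` `[0, 1].

Definition grid_index := ({ffun 'I_d -> 'I_m.+1} * {ffun 'I_d -> 'I_l.+1})%type.

Definition corner (c : {ffun 'I_d -> 'I_m.+1}) : 'rV[R]_d :=
  \row_k ((c k)%:R / m%:R).

Definition monomial (c : 'rV[R]_d) (g : {ffun 'I_d -> 'I_l.+1}) (x : 'rV[R]_d) : R :=
  \prod_k (x ord0 k - c ord0 k) ^+ g k.

Definition feature (cg : grid_index) (x : 'rV[R]_d) : R :=
  (\prod_k \1_(grid_interval (cg.1 k)) (x ord0 k)) * monomial (corner cg.1) cg.2 x.

Lemma measurable_feature cg : measurable_fun setT (feature cg).
Proof.
apply: measurable_funM; apply: measurable_prod => k _.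
  apply: measurableT_comp; last exact: measurable_coor.
  by apply: measurable_indic; exact: measurableI.
by apply: measurable_funX; apply: measurable_funB => //; exact: measurable_coor.
Qed.

Lemma unit_cube_corner c : unit_cube (corner c).
Proof.
move=> k; rewrite mxE divr_ge0//= ler_pdivrMr ?ltr0n// mul1r ler_nat.
by rewrite -ltnS.
Qed.

Let mR : 0 < m%:R :> R. Proof. by rewrite ltr0n. Qed.

Lemma cell_of (x : 'rV[R]_d) : unit_cube x ->
  exists c : {ffun 'I_d -> 'I_m.+1}, forall k (j : 'I_m.+1),
    grid_interval j (x ord0 k) <-> j = c k.
Proof.
move=> cx; have bnd k : (Num.truncn (m%:R * x ord0 k) < m.+1)%N.
  have /andP[x0 x1] := cx k.
  rewrite -(ltr_nat R); apply: (@le_lt_trans _ _ (m%:R * x ord0 k)).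
    by rewrite truncn_le// mulr_ge0.
  apply: (@le_lt_trans _ _ m%:R); last by rewrite ltr_nat.
  by rewrite ler_piMr.
exists [ffun k => Ordinal (bnd k)] => k j.
rewrite /grid_interval/= !in_itv/= ffunE.
have /andP[x0 x1] := cx k; have y0 : 0 <= m%:R * x ord0 k by rewrite mulr_ge0.
rewrite ler_pdivrMr// ltr_pdivlMr// [x ord0 k * _]mulrC.
split=> [[jx _]|->].
  by apply/val_inj => /=; apply/esym/eqP; rewrite truncn_eq.
split; last by rewrite x0.
by rewrite /=; exact: truncn_itv.
Qed.

Lemma feature_out x cg : ~ unit_cube x -> feature cg x = 0.
Proof.
move=> /existsNP[k nk]; rewrite /feature (bigD1 k)//= indicE memNset ?mul0r//.
by move=> -[_]; rewrite /= in_itv.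
Qed.

(** A point of the cube lies in exactly one cell, so only the features of that cell
    contribute; outside the cube all the features vanish. *)
Lemma sum_feature (h : 'rV[R]_d -> R)
    (th : {ffun 'I_d -> 'I_m.+1} -> {ffun 'I_d -> 'I_l.+1} -> R) (eps : R) :
  0 <= eps -> (forall x, ~ unit_cube x -> h x = 0) ->
  (forall c x, unit_cube x ->
     (forall k, corner c ord0 k <= x ord0 k <= corner c ord0 k + m%:R^-1) ->
     `|h x - \sum_g th c g * monomial (corner c) g x| <= eps) ->
  forall x, `|h x - \sum_cg feature cg x * th cg.1 cg.2| <= eps.
Proof.
move=> eps0 h0 happrox x.
have [cx|ncx] := pselect (unit_cube x); last first.
  rewrite h0// big1 ?subr0 ?normr0// => cg _.
  by rewrite feature_out// mul0r.
have [c cE] := cell_of cx.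
have ind0 c' : c' != c -> \prod_k \1_(grid_interval (c' k)) (x ord0 k) = 0 :> R.
  move=> cc'; have [k ck] : exists k, c' k != c k.
    apply/existsP; apply: contraNT cc'; rewrite negb_exists => /forallP e.
    by apply/eqP/ffunP => k; apply/eqP; move: (e k); rewrite negbK.
  rewrite (bigD1 k)//= indicE memNset ?mul0r//.
  by move/cE => /eqP; rewrite (negbTE ck).
have ind1 : \prod_k \1_(grid_interval (c k)) (x ord0 k) = 1 :> R.
  by rewrite big1// => k _; rewrite indicE mem_set//; exact/cE.
have -> : \sum_cg feature cg x * th cg.1 cg.2 =
    \sum_g th c g * monomial (corner c) g x.
  rewrite -(pair_big xpredT xpredT (fun c' g => feature (c', g) x * th c' g))/=.
  rewrite (bigD1 c)//= [X in _ + X]big1 ?addr0 => [|c' cc'].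
    by apply: eq_bigr => g _; rewrite /feature/= ind1 mul1r mulrC.
  by rewrite big1// => g _; rewrite /feature/= ind0// !mul0r.
apply: happrox => // k; have [_ /(_ erefl)[]] := cE k (c k).
rewrite /= in_itv/= => /andP[a b] _; rewrite mxE a/=.
by rewrite (le_trans (ltW b))// -[X in _ + X]mul1r -mulrDl -natr1.
Qed.

End grid.

(** * Taylor expansion one coordinate at a time *)

Section taylor_line.
Context (R : realType).

Lemma is_derive_taylor_monomial (c : R) (a : nat) (t : R) :
  is_derive t 1 (fun x => c * (x ^+ a.+1 / a.+1`!%:R)) (c * (t ^+ a / a`!%:R)).
Proof.
have h : is_derive t 1 ((c / a.+1`!%:R) *: (id ^+ a.+1 : R -> R))
    ((c / a.+1`!%:R) *: ((a.+1%:R * t ^+ a) *: (1 : R))).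
  exact: is_deriveZ.
rewrite (_ : (fun _ => _) = (c / a.+1`!%:R) *: (id ^+ a.+1 : R -> R)); last first.
  by apply/funext => x; rewrite /= fctE /= -[RHS]/(_ * (x ^+ a.+1)) mulrA mulrAC.
apply: is_derive_eq h _; rewrite scaler1 -[LHS]/(_ * _).
have f0 : a`!%:R != 0 :> R by rewrite pnatr_eq0 -lt0n fact_gt0.
rewrite factS natrM; field.
by rewrite f0 /= (_ : 1 + a%:R = a.+1%:R) ?pnatr_eq0// -natr1 addrC.
Qed.

(** The derivative of the remainder of [g 0] is the remainder of [g 1], so the
    mean value theorem gains one power of [t] at each step. *)
Lemma taylor_segment (k : nat) (g : nat -> R -> R) (tau eps : R) :
  (forall a t, (a < k)%N -> 0 <= t <= tau -> is_derive t 1 (g a) (g a.+1 t)) ->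
  (forall t, 0 <= t <= tau -> `|g k t - g k 0| <= eps) ->
  forall t, 0 <= t <= tau ->
    `|g 0%N t - \sum_(a < k.+1) g a 0 * (t ^+ a / a`!%:R)| <= eps * t ^+ k.
Proof.
elim: k g => [|k IH] g dg gk t tt.
  by rewrite big_ord_recl big_ord0 fact0 expr0 divr1 !mulr1 addr0 gk.
have /andP[t0 t1] := tt.
have IH' := IH (fun a => g a.+1) (fun a t ak => dg a.+1 t ak) gk.
pose r x := g 0%N x - (g 0%N 0 + \sum_(a < k.+1) g a.+1 0 * (x ^+ a.+1 / a.+1`!%:R)).
have rE x : g 0%N x - \sum_(a < k.+2) g a 0 * (x ^+ a / a`!%:R) = r x.
  by rewrite big_ord_recl fact0 expr0 divr1 mulr1.
pose dr x := g 1%N x - \sum_(a < k.+1) g a.+1 0 * (x ^+ a / a`!%:R).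
have r'E x : 0 <= x <= tau -> is_derive x 1 r (dr x).
  move=> xx; have h0 := dg 0%N x isT xx.
  have h1 : is_derive x 1 (cst (g 0%N 0) + \sum_(a < k.+1)
       (fun y => g a.+1 0 * (y ^+ a.+1 / a.+1`!%:R)))
     (0 + \sum_(a < k.+1) g a.+1 0 * (x ^+ a / a`!%:R)).
    apply: is_deriveD; apply: is_derive_sum => a.
    exact: is_derive_taylor_monomial.
  rewrite add0r in h1.
  have -> : r = g 0%N - (cst (g 0%N 0) + \sum_(a < k.+1)
       (fun y => g a.+1 0 * (y ^+ a.+1 / a.+1`!%:R))).
    by apply/funext => y; rewrite /r !fctE fct_sumE.
  exact: is_deriveB.
rewrite rE.
have [|c|c ct rc] := @MVT_segment R r dr 0 t t0.
- move=> x; rewrite in_itv/= => /andP[x0 xt]; apply: r'E.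
  by rewrite (ltW x0) (le_trans (ltW xt)).
- apply: derivable_within_continuous => x; rewrite in_itv/= => /andP[x0 xt].
  by have [] : is_derive x 1 r (dr x) by apply: r'E; rewrite x0 (le_trans xt).
move: ct; rewrite in_itv/= => /andP[c0 ct].
have r0 : r 0 = 0.
  rewrite /r big1 ?addr0 ?subrr// => a _; by rewrite expr0n/= mul0r mulr0.
rewrite -[r t]subr0 -r0 rc subr0 normrM (ger0_norm t0).
rewrite exprSr mulrA ler_wpM2r//.
apply: (le_trans (IH' c _)); first by rewrite c0 (le_trans ct).
rewrite ler_wpM2l ?lerXn2r//.
by apply: le_trans (gk 0 _); rewrite ?subrr ?normr0// lexx (le_trans t0).
Qed.

End taylor_line.

Section multi_index.
Context (R : realType) (d l : nat).
Local Notation mi := {ffun 'I_d -> 'I_l.+1}.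
Implicit Types (g : mi) (F : 'rV[R]_d -> R).

(** The order in which [partial_mi] differentiates: the derivatives along the last
    coordinates are taken first. *)
Definition mi_word g : seq 'I_d := flatten [seq nseq (g i) i | i <- enum 'I_d].

Definition mi_upd g (j : 'I_d) (b : 'I_l.+1) : mi :=
  [ffun i => if i == j then b else g i].

Lemma size_mi_word g : size (mi_word g) = order_mi g.
Proof.
rewrite /mi_word size_flatten /shape -map_comp sumnE big_map /order_mi big_enum/=.
by apply: eq_bigr => i _; rewrite /= size_nseq.
Qed.

Lemma order_mi_upd g j b : g j = 0%N :> nat ->
  order_mi (mi_upd g j b) = (b + order_mi g)%N.
Proof.
move=> gj; rewrite /order_mi (bigD1 j)//= ffunE eqxx [in RHS](bigD1 j)//= gj add0n.
by congr (_ + _)%N; apply: eq_bigr => i ij; rewrite ffunE (negbTE ij).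
Qed.

(** Differentiating along [j] a partial derivative that involves only coordinates
    after [j] gives again a derivative in the canonical order. Expanding one
    coordinate at a time from the last to the first therefore never requires to
    exchange partial derivatives. *)
Lemma mi_word_upd g (j : 'I_d) b : (forall i : 'I_d, (i <= j)%N -> g i = 0%N :> nat) ->
  mi_word (mi_upd g j b) = nseq b j ++ mi_word g.
Proof.
move=> g0; rewrite /mi_word.
have : sorted ltn (map val (enum 'I_d)) by rewrite val_enum_ord iota_ltn_sorted.
have : uniq (enum 'I_d) by exact: enum_uniq.
case/splitPr: (mem_enum 'I_d j) => s1 s2 u so.
have s1j i : i \in s1 -> (i < j)%N.
  move=> is1; move: so; rewrite map_cat/= (sorted_pairwise ltn_trans) pairwise_cat.
  by case/and3P => /allrelP h _ _; apply: h; [exact: map_f|rewrite inE eqxx].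
have s2j i : i \in s2 -> i != j.
  move=> is2; apply/eqP => ij; move: u; rewrite cat_uniq => /and3P[_ _ /=/andP[]].
  by rewrite -ij is2.
rewrite !map_cat !flatten_cat/= ffunE eqxx (g0 j)//= .
have z (h : mi) : (forall i, i \in s1 -> h i = 0%N :> nat) ->
    flatten [seq nseq (h i) i | i <- s1] = [::].
  move=> h0; elim: s1 h0 {so u s1j} => //= i s IH h0.
  by rewrite h0 ?mem_head//= IH// => k ks; rewrite h0// inE ks orbT.
rewrite !z/= => [|i /s1j ij|i /s1j ij]; last 2 first.
- by rewrite g0// ltnW.
- by rewrite ffunE ifF ?g0 ?(ltnW ij)//; apply/negbTE; rewrite -val_eqE/= neq_ltn ij.
congr (_ ++ flatten _); apply/eq_in_map => i /s2j ij.
by rewrite ffunE (negbTE ij).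
Qed.

Lemma monomial_upd (c x x' : 'rV[R]_d) g (j : 'I_d) b :
  g j = 0%N :> nat -> (forall k, k != j -> x' ord0 k = x ord0 k) ->
  monomial c (mi_upd g j b) x = (x ord0 j - c ord0 j) ^+ b * monomial c g x'.
Proof.
move=> gj xx'; rewrite /monomial (bigD1 j)//= ffunE eqxx; congr (_ * _).
rewrite [RHS](bigD1 j)//= gj expr0 mul1r; apply: eq_bigr => k kj.
by rewrite ffunE (negbTE kj) xx'.
Qed.

End multi_index.

Section partial_line.
Context (R : realType) (d : nat).

Lemma is_derive_line (G : 'rV[R]_d -> R) (x v : 'rV[R]_d) (t : R) :
  derivable G (x + t *: v) v ->
  is_derive t 1 (fun t => G (x + t *: v)) ('D_v G (x + t *: v)).
Proof.
move=> dG.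
have E : (fun h : R => h^-1 *: (((fun t => G (x + t *: v)) \o shift t) (h *: 1) - G (x + t *: v)))
  = (fun h => h^-1 *: ((G \o shift (x + t *: v)) (h *: v) - G (x + t *: v))).
  apply/funext => h /=; congr (_ *: (G _ - _)).
  by rewrite -[h *: 1]/(h * 1) mulr1 scalerDl addrCA.
by split; rewrite /derivable /derive E.
Qed.
End partial_line.

Section taylor_box.
Context (R : realType) (d l : nat) (U : set 'rV[R]_d) (F : 'rV[R]_d -> R)
  (L alpha : R).
Local Notation mi := {ffun 'I_d -> 'I_l.+1}.
Local Notation cube := (@unit_cube R d).
Hypotheses (cubeU : cube `<=` U) (L_ge0 : 0 <= L) (alpha_ge0 : 0 <= alpha).
Hypothesis F_class : of_class l U F.
Hypothesis F_bound : forall (g : mi) x, (order_mi g <= l)%N -> cube x ->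
  `|partial_mi g F x| <= L.
Hypothesis F_holder : forall (g : mi) x y, order_mi g = l -> cube x -> cube y ->
  `|partial_mi g F x - partial_mi g F y| <= L * euclidean_norm (x - y) `^ alpha.

Lemma euclidean_norm_basis (t : R) j : euclidean_norm (t *: basis_vector R j : 'rV[R]_d) = `|t|.
Proof.
rewrite /euclidean_norm (bigD1 j)//= big1 => [|k kj].
  by rewrite !mxE !eqxx mulr1 addr0 sqrtr_sqr.
by rewrite !mxE eqxx (negbTE kj) mulr0 expr0n.
Qed.

Definition move_coord (x : 'rV[R]_d) (j : 'I_d) (a : R) : 'rV[R]_d :=
  \row_k (if k == j then a else x ord0 k).

Lemma move_coordE x j a : move_coord x j a =
  x + (a - x ord0 j) *: basis_vector R j.
Proof.
apply/rowP => k; rewrite !mxE eqxx/=; case: eqP => [->|_].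
  by rewrite mulr1 subrKC.
by rewrite mulr0 addr0.
Qed.

Variables (c : 'rV[R]_d) (r : R).
Hypotheses (c_cube : cube c) (r_ge0 : 0 <= r).
Local Notation N := (#|{: mi}|%:R : R).

Definition supported (j : nat) (th : mi -> R) :=
  forall (g : mi) (k : 'I_d), (j <= k)%N -> g k != 0%N :> nat -> th g = 0.

(** Taylor's formula in the [j]-th coordinate, the others being frozen; the segment
    from [move_coord x j (c ord0 j)] to [x] stays in the cube. *)
Lemma taylor_coord (g : mi) (j : 'I_d) (x : 'rV[R]_d) :
  (order_mi g <= l)%N -> (forall i : 'I_d, (i <= j)%N -> g i = 0%N :> nat) ->
  cube x -> c ord0 j <= x ord0 j <= c ord0 j + r ->
  `|partial_mi g F x - \sum_(b < (l - order_mi g).+1)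
       partial_mi (mi_upd g j (inord b)) F (move_coord x j (c ord0 j)) *
         ((x ord0 j - c ord0 j) ^+ b / b`!%:R)| <=
  L * r `^ alpha * r ^+ (l - order_mi g).
Proof.
move=> gl g0 cx /andP[cj xj].
set k := (l - order_mi g)%N.
pose v := basis_vector R j; pose x' := move_coord x j (c ord0 j).
pose tau := x ord0 j - c ord0 j.
have tau0 : 0 <= tau by rewrite subr_ge0.
have taur : tau <= r by rewrite lerBlDl.
pose G a := iterated_partial (nseq a j ++ mi_word g) F.
have xE : x = x' + tau *: v.
  by rewrite /x' move_coordE -addrA -scalerDl -opprB addNr scale0r addr0.
have GE b : (b <= k)%N -> G b = partial_mi (mi_upd g j (inord b)) F.
  move=> bk; have bl : (b < l.+1)%N by rewrite ltnS (leq_trans bk)// leq_subr.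
  by rewrite /partial_mi -/(mi_word _) mi_word_upd// inordK.
have line t : 0 <= t <= tau -> cube (x' + t *: v).
  move=> /andP[t0 t1] i; rewrite !mxE eqxx/=; case: (eqVneq i j) => [_|ij].
    have /andP[c0 _] := c_cube j; have /andP[_ x1] := cx j.
    by rewrite mulr1 addr_ge0//= (le_trans _ x1)// -lerBrDl.
  by rewrite mulr0 addr0.
have sz a : size (nseq a j ++ mi_word g) = (a + order_mi g)%N.
  by rewrite size_cat size_nseq size_mi_word.
have := @taylor_segment R k (fun a t => G a (x' + t *: v)) tau (L * r `^ alpha).
have GT : partial_mi g F = G 0%N by [].
move=> /(_ _ _ tau) H; rewrite GT {1}xE.
apply: (le_trans (y := L * r `^ alpha * tau ^+ k)); last first.
  by rewrite ler_wpM2l ?mulr_ge0 ?powR_ge0// lerXn2r// nnegrE.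
rewrite [X in `|_ - X|](_ : _ = \sum_(a < k.+1) G a (x' + 0 *: v) * (tau ^+ a / a`!%:R)).
  apply: H.
  - move=> a t ak tt; apply: is_derive_line.
    have [|_] := F_class (w := nseq a j ++ mi_word g) _ (cubeU (line _ tt)).
      by rewrite sz; rewrite /k in ak; lia.
    by apply; rewrite sz; rewrite /k in ak; lia.
  - move=> t tt; rewrite GE// scale0r addr0.
    have kl : (k < l.+1)%N by rewrite ltnS leq_subr.
    apply: (le_trans (F_holder _ _ _)).
    + by rewrite order_mi_upd ?g0// inordK// subnK.
    + exact: line.
    + by have := line 0; rewrite scale0r addr0 lexx => /(_ tau0).
    rewrite addrC addKr euclidean_norm_basis ler_wpM2l// ge0_ler_powR//.
      by have /andP[t0 t1] := tt; rewrite ger0_norm// (le_trans t1).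
  - by rewrite tau0/=.
by apply: eq_bigr => b _; rewrite scale0r addr0 GE// -ltnS.
Qed.

Let mi0 : mi := [ffun=> ord0].

Let order_step (g : mi) (b : nat) : (order_mi g <= l)%N -> (b < (l - order_mi g).+1)%N ->
  (b < l.+1)%N.
Proof. by move=> gl bk; lia. Qed.

(** Each derivative in the expansion along [j] is evaluated at a point whose [j]-th
    coordinate is that of [c], where the induction hypothesis provides a polynomial
    in the coordinates before [j]; multiplying by powers of the [j]-th coordinate
    and collecting monomials gives the polynomial in one more coordinate. *)
Lemma taylor_box_step (j : 'I_d) (K M : R) :
  0 <= K -> 0 <= M ->
  (forall g : mi, (order_mi g <= l)%N -> (forall i : 'I_d, (i < j)%N -> g i = 0%N :> nat) ->
    exists th, [/\ forall h, `|th h| <= M, supported j th &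
      forall x, cube x -> (forall k, c ord0 k <= x ord0 k <= c ord0 k + r) ->
        (forall k : 'I_d, (j <= k)%N -> x ord0 k = c ord0 k) ->
        `|partial_mi g F x - \sum_h th h * monomial c h x| <=
          K * (r `^ alpha * r ^+ (l - order_mi g))]) ->
  (forall g : mi, (order_mi g <= l)%N -> (forall i : 'I_d, (i < j.+1)%N -> g i = 0%N :> nat) ->
    exists th, [/\ forall h, `|th h| <= l.+1%:R * N * M, supported j.+1 th &
      forall x, cube x -> (forall k, c ord0 k <= x ord0 k <= c ord0 k + r) ->
        (forall k : 'I_d, (j.+1 <= k)%N -> x ord0 k = c ord0 k) ->
        `|partial_mi g F x - \sum_h th h * monomial c h x| <=
          (L + l.+1%:R * K) * (r `^ alpha * r ^+ (l - order_mi g))]).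
Proof.
move=> K0 M0 IH g gl g0; set k := (l - order_mi g)%N.
have gj : g j = 0%N :> nat by apply: g0.
have ord_upd (b : 'I_k.+1) : order_mi (mi_upd g j (inord b)) = (b + order_mi g)%N.
  by rewrite order_mi_upd// inordK// (order_step gl (ltn_ord b)).
have /choice[th Hth] : forall b : 'I_k.+1, exists th, [/\ forall h, `|th h| <= M, supported j th &
      forall x, cube x -> (forall k, c ord0 k <= x ord0 k <= c ord0 k + r) ->
        (forall k : 'I_d, (j <= k)%N -> x ord0 k = c ord0 k) ->
        `|partial_mi (mi_upd g j (inord b)) F x - \sum_h th h * monomial c h x| <=
          K * (r `^ alpha * r ^+ (k - b))].
  move=> b; have [||th [h1 h2 h3]] := IH (mi_upd g j (inord b)).
  - by rewrite ord_upd; have := ltn_ord b; rewrite /k; lia.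
  - move=> i ij; rewrite ffunE ifF; first by apply: g0; exact: ltnW.
    by apply/negbTE; rewrite -val_eqE/= neq_ltn ij.
  exists th; split=> // x cx cxr xc.
  by rewrite (_ : k - b = l - order_mi (mi_upd g j (inord b)))%N ?h3// ord_upd /k; lia.
(* collects the products of the monomial [h'] and of the [b]-th power of
   the [j]-th coordinate *)
pose th' (h : mi) : R := \sum_(b < k.+1) \sum_(h' : mi)
  (if h == mi_upd h' j (inord b) then th b h' / b`!%:R else 0).
have fact_ge1 b : 1 <= b`!%:R :> R by rewrite ler1n fact_gt0.
have kl : k.+1%:R <= l.+1%:R :> R by rewrite ler_nat ltnS leq_subr.
exists th'; split.
- move=> h; apply: (le_trans (ler_norm_sum _ _ _)).
  apply: (@le_trans _ _ (\sum_(b < k.+1) N * M)); last first.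
    rewrite sumr_const card_ord -[leLHS]mulr_natl -[leRHS]mulrA ler_wpM2r ?mulr_ge0//.
  apply: ler_sum => b _; apply: (le_trans (ler_norm_sum _ _ _)).
  apply: (@le_trans _ _ (\sum_(h' : mi) M)); last by rewrite sumr_const mulr_natl.
  apply: ler_sum => h' _; case: ifP => _; last by rewrite normr0.
  have [h1 _ _] := Hth b; rewrite normrM normfV normr_nat.
  rewrite ler_pdivrMr ?(lt_le_trans ltr01)//.
  by apply: le_trans (h1 h') _; rewrite ler_peMr.
- move=> h i ji hi; apply: big1 => b _; apply: big1 => h' _; case: eqP => // hE.
  have [_ h2 _] := Hth b; rewrite (h2 h' i) ?mul0r ?(ltnW ji)//.
  move: hi; rewrite hE ffunE ifF//; apply/negbTE.
  by rewrite -val_eqE/= neq_ltn ji orbT.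
move=> x cx cxr xc; set x' := move_coord x j (c ord0 j).
set tau := x ord0 j - c ord0 j.
have tau0 : 0 <= tau by rewrite subr_ge0; have /andP[] := cxr j.
have taur : tau <= r by rewrite lerBlDl; have /andP[] := cxr j.
have x'E i : i != j -> x' ord0 i = x ord0 i by move=> ij; rewrite mxE (negbTE ij).
have x'j : x' ord0 j = c ord0 j by rewrite mxE eqxx.
have cx' : cube x' by move=> i; have [->|ij] := eqVneq i j; rewrite ?x'j ?x'E.
have bx' i : c ord0 i <= x' ord0 i <= c ord0 i + r.
  by have [->|ij] := eqVneq i j; rewrite ?x'j ?x'E// lexx lerDl.
have xc' (i : 'I_d) : (j <= i)%N -> x' ord0 i = c ord0 i.
  rewrite leq_eqVlt => /orP[/eqP ji|ji].
    by have -> : i = j by exact/val_inj/esym.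
  by rewrite x'E ?xc// -val_eqE/= neq_ltn ji orbT.
have -> : \sum_h th' h * monomial c h x = \sum_(b < k.+1)
    (\sum_h th b h * monomial c h x') * (tau ^+ b / b`!%:R).
  under eq_bigr do rewrite mulr_suml.
  rewrite exchange_big/=; apply: eq_bigr => b _.
  under eq_bigr do rewrite mulr_suml.
  rewrite exchange_big/= mulr_suml; apply: eq_bigr => h' _.
  rewrite (bigD1 (mi_upd h' j (inord b)))//= eqxx big1 ?addr0; last first.
    by move=> h /negbTE ->; rewrite mul0r.
  have [h'j|h'j] := eqVneq (h' j : nat) 0%N; last first.
    by have [_ h2 _] := Hth b; rewrite (h2 h' j)// !mul0r.
  rewrite (monomial_upd c _ h'j x'E) inordK ?(order_step gl (ltn_ord b))//.
  by rewrite -/tau; ring.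
have step := taylor_coord gl g0 cx (cxr j).
set S := (X in `|_ - X| <= _) in step.
rewrite -(subrK S (partial_mi g F x)) -addrA.
apply: le_trans (ler_normD _ _) _; rewrite mulrDl lerD//; first by rewrite mulrA.
rewrite /S -sumrB; apply: (le_trans (ler_norm_sum _ _ _)).
apply: (@le_trans _ _ (\sum_(b < k.+1) K * (r `^ alpha * r ^+ k))); last first.
  rewrite sumr_const card_ord -[leLHS]mulr_natl -[leRHS]mulrA ler_wpM2r//.
  by rewrite !mulr_ge0 ?powR_ge0 ?exprn_ge0.
apply: ler_sum => b _; rewrite -mulrBl normrM.
have [_ _ /(_ x' cx' bx' xc') h3] := Hth b.
have -> : K * (r `^ alpha * r ^+ k) = K * (r `^ alpha * r ^+ (k - b)) * r ^+ b.
  by rewrite -!mulrA -exprD subnK// -ltnS.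
rewrite ler_pM// ger0_norm ?divr_ge0 ?exprn_ge0//.
rewrite ler_pdivrMr ?(lt_le_trans ltr01)//.
apply: (@le_trans _ _ (r ^+ b)); first by rewrite lerXn2r// nnegrE.
by rewrite ler_peMr ?exprn_ge0.
Qed.

(** Adding one coordinate turns the constant [K] into [L + l.+1 * K], whence the
    powers of [l.+2]. *)
Lemma taylor_box_induction (j : nat) : (j <= d)%N ->
  forall g : mi, (order_mi g <= l)%N -> (forall i : 'I_d, (i < j)%N -> g i = 0%N :> nat) ->
    exists th, [/\ forall h, `|th h| <= (l.+1%:R * N) ^+ j * L, supported j th &
      forall x, cube x -> (forall k, c ord0 k <= x ord0 k <= c ord0 k + r) ->
        (forall k : 'I_d, (j <= k)%N -> x ord0 k = c ord0 k) ->
        `|partial_mi g F x - \sum_h th h * monomial c h x| <=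
          (L * l.+2%:R ^+ j) * (r `^ alpha * r ^+ (l - order_mi g))].
Proof.
elim: j => [_ g gl _|j IH jd].
  exists (fun h => if h == mi0 then partial_mi g F c else 0); split.
  - move=> h; rewrite expr0 mul1r; case: ifP => _; last by rewrite normr0.
    exact: F_bound.
  - move=> h k _ hk; rewrite ifF//; apply/negbTE; apply: contra hk => /eqP ->.
    by rewrite ffunE.
  move=> x _ _ xc; have -> : x = c by apply/rowP => k; rewrite xc.
  rewrite (bigD1 mi0)//= eqxx big1 => [|h /negbTE ->]; last by rewrite mul0r.
  have -> : monomial c mi0 c = 1.
    by rewrite /monomial big1// => k _; rewrite ffunE expr0.
  by rewrite mulr1 addr0 subrr normr0 !mulr_ge0 ?exprn_ge0 ?powR_ge0.
move=> g gl g0; have K0 : 0 <= L * l.+2%:R ^+ j by rewrite mulr_ge0 ?exprn_ge0.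
have M0 : 0 <= (l.+1%:R * N) ^+ j * L by rewrite mulr_ge0 ?exprn_ge0 ?mulr_ge0.
have [th [h1 h2 h3]] := @taylor_box_step (Ordinal jd) _ _ K0 M0 (IH (ltnW jd)) g gl g0.
exists th; split=> // [h|x cx cxr xc].
  by rewrite exprS -mulrA h1.
apply: le_trans (h3 x cx cxr xc) _.
rewrite ler_wpM2r ?mulr_ge0 ?powR_ge0 ?exprn_ge0//.
have p1 : 1 <= l.+2%:R ^+ j :> R by rewrite exprn_ege1// ler1n.
have -> : L * l.+2%:R ^+ j.+1 = L * l.+2%:R ^+ j + l.+1%:R * (L * l.+2%:R ^+ j).
  by rewrite exprS -natr1; ring.
by rewrite lerD2r ler_peMr.
Qed.

Lemma taylor_box : exists th : mi -> R,
  (forall h, `|th h| <= (l.+1%:R * N) ^+ d * L) /\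
  forall x, cube x -> (forall k, c ord0 k <= x ord0 k <= c ord0 k + r) ->
    `|F x - \sum_h th h * monomial c h x| <= (L * l.+2%:R ^+ d) * (r `^ alpha * r ^+ l).
Proof.
have o0 : order_mi mi0 = 0%N by rewrite /order_mi big1// => i _; rewrite ffunE.
have w0 : partial_mi mi0 F = F.
  rewrite /partial_mi -/(mi_word mi0) (_ : mi_word mi0 = [::])//.
  by apply: size0nil; rewrite size_mi_word.
have [||th [h1 _ h3]] := @taylor_box_induction d (leqnn d) mi0.
- by rewrite o0.
- by move=> i _; rewrite ffunE.
exists th; split=> // x cx cxr; rewrite w0 o0 subn0 in h3; apply: h3 => // k.
by rewrite leqNgt ltn_ord.
Qed.

End taylor_box.

(** * Polynomial approximation in Hoelder balls *)

Section lebesgue_box.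
Context (R : realType) (d : nat).

Lemma lebesgue_rV_box (S : 'I_d -> set R) : (forall k, measurable (S k)) ->
  @lebesgue_rV R d [set x | forall k, S k (x ord0 k)] =
  (\prod_k lebesgue_measure (S k))%E.
Proof.
move=> mS; rewrite -tuple_measure_box// /lebesgue_rV /pushforward.
by congr (tuple_measure _ _ _); apply/seteqP; split=> t /= h k; move: (h k); rewrite /= mxE.
Qed.

Lemma measurable_box (S : 'I_d -> set R) : (forall k, measurable (S k)) ->
  measurable [set x : 'rV[R]_d | forall k, S k (x ord0 k)].
Proof.
move=> mS; rewrite (_ : [set x | _] =
    \bigcap_(k in [set: 'I_d]) ((fun x : 'rV[R]_d => x ord0 k) @^-1` S k)).
  apply: fin_bigcap_measurable => // k _.
  by rewrite -[X in measurable X]setTI; exact: measurable_coor.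
by apply/seteqP; split => x /= h k; [move=> _; exact: h|exact: h].
Qed.

Lemma lebesgue_rV_ball_gt0 (x : 'rV[R]_d) (e : R) : 0 < e ->
  exists2 B : set 'rV[R]_d, measurable B & (B `<=` ball x e /\ 0 < @lebesgue_rV R d B)%E.
Proof.
move=> e0; pose S (k : 'I_d) : set R := `]x ord0 k - e, x ord0 k + e[%classic.
exists [set y | forall k, S k (y ord0 k)]; first by apply: measurable_box => k; exact: measurable_itv.
split.
  move=> y /= yS; split=> // i k; rewrite (ord1 i); have := yS k.
  by rewrite /S/= in_itv/= -ltr_distlC.
rewrite lebesgue_rV_box; last by move=> k; exact: measurable_itv.
have -> : (\prod_k lebesgue_measure (S k))%E = (\prod_(k < d) (e *+ 2))%:E.
  rewrite -prodEFin; apply: eq_bigr => k _; rewrite /S lebesgue_measure_itv/=.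
  rewrite lte_fin ltrBlDr -addrA ltrDl addr_gt0// -EFinD.
  by congr EFin; rewrite mulr2n; ring.
by rewrite lte_fin prodr_gt0// => k _; rewrite mulrn_wgt0.
Qed.

Lemma lebesgue_rV_gt0 : (0 < @lebesgue_rV R d setT)%E.
Proof.
have [B mB [_ B0]] := lebesgue_rV_ball_gt0 0 ltr01.
by apply: lt_le_trans B0 _; apply: le_measure; rewrite ?inE.
Qed.

(** If the bound failed at [x], it would fail on a ball, which contains a box of
    positive measure. *)
Lemma continuous_le_Lnorm (O : set 'rV[R]_d) (G : 'rV[R]_d -> R) (L : R) x :
  open O -> O x -> {for x, continuous G} ->
  ('N[@lebesgue_rV R d]_+oo [EFin \o (G \_ O)] <= L%:E)%E -> `|G x| <= L.
Proof.
move=> oO Ox cG; rewrite unlock lebesgue_rV_gt0 => /ess_supP [N [mN N0 subN]].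
rewrite leNgt; apply/negP => LG.
have nO : nbhs x O by apply: open_nbhs_nbhs; split.
have cn : `|G y| @[y --> x] --> `|G x| by apply: (@cvg_norm _ _ _ (nbhs x) _ G (G x)); exact: cG.
have nG : \forall y \near x, L < `|G y| by exact: (cvgr_gt _ cn).
have : nbhs x (O `&` [set y | L < `|G y|]) by apply: filterI.
move=> /nbhs_ballP[e /= e0 eO].
have [B mB [Be B0]] := lebesgue_rV_ball_gt0 x e0.
suff : (@lebesgue_rV R d B <= 0)%E by rewrite leNgt B0.
rewrite -N0; apply: le_measure; rewrite ?inE//.
move=> y /Be /eO [Oy Ly]; apply: subN => /=.
rewrite patchE mem_set// lee_fin => /le_lt_trans /(_ Ly).
by rewrite ltxx.
Qed.

End lebesgue_box.

Section holder_approx.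
Context (R : realType) (d : nat) (s L : R) (U : set 'rV[R]_d) (F : 'rV[R]_d -> R).
Local Notation l := (holder_order s).
Local Notation alpha := (holder_exponent s).
Hypotheses (s_gt0 : 0 < s) (L_ge0 : 0 <= L) (oU : open U).
Hypothesis cubeU : @unit_cube R d `<=` U.
Hypothesis FL : holder_ball s U L F.

Lemma holder_exponent_gt0 : 0 < alpha.
Proof.
have c0 : (0 < Num.ceil s)%R by rewrite ceil_gt0.
rewrite /holder_exponent subr_gt0 /holder_order.
have := ceilB1_lt s; case: (Num.ceil s) c0 => // -[|k] // _.
by rewrite intS [X in (X - 1)%:~R]addrC addrK.
Qed.

Lemma holder_ball_partial_le (g : {ffun 'I_d -> 'I_l.+1}) x :
  (order_mi g <= l)%N -> unit_cube x -> `|partial_mi g F x| <= L.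
Proof.
have [Fc Fn] := FL.
move=> gl cx; apply: (continuous_le_Lnorm oU (cubeU cx)).
  by have [] := Fc (mi_word g) _ x (cubeU cx); rewrite size_mi_word.
apply: le_trans Fn; rewrite /holder_norm (bigD1 g)//=.
rewrite -addeA leeDl// adde_ge0//; first by apply: sume_ge0 => h _; exact: Lnorm_ge0.
by rewrite /holder_seminorm; apply: bigmax_ge_id.
Qed.

Lemma holder_ball_increment (g : {ffun 'I_d -> 'I_l.+1}) x y :
  order_mi g = l -> unit_cube x -> unit_cube y ->
  `|partial_mi g F x - partial_mi g F y| <= L * euclidean_norm (x - y) `^ alpha.
Proof.
have [Fc Fn] := FL.
move=> gl cx cy; have [->|xy] := eqVneq x y.
  by rewrite subrr normr0 mulr_ge0// powR_ge0.
have n0 : 0 < euclidean_norm (x - y) `^ alpha.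
  rewrite powR_gt0// sqrtr_gt0 lt_neqAle sumr_ge0 ?andbT => [|i _]; last exact: sqr_ge0.
  apply: contra xy; rewrite eq_sym psumr_eq0 => [/allP h|i _]; last exact: sqr_ge0.
  apply/eqP/rowP => k; have := h k (mem_index_enum k).
  by rewrite sqrf_eq0 !mxE subr_eq0 => /eqP.
rewrite -ler_pdivrMr// -lee_fin; apply: le_trans Fn.
rewrite /holder_norm; apply: (@le_trans _ _ (holder_seminorm l alpha U F)); last first.
  by rewrite leeDr// sume_ge0// => h _; exact: Lnorm_ge0.
rewrite /holder_seminorm; apply: le_trans (le_bigmax_cond _ _ (j := g) _); last exact/eqP.
by apply: ereal_sup_ubound; exists x, y; split=> //; exact: cubeU.
Qed.

Lemma holder_ball_taylor (c : 'rV[R]_d) (r : R) : unit_cube c -> 0 <= r ->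
  exists th : {ffun 'I_d -> 'I_l.+1} -> R,
  (forall h, `|th h| <=
     (l.+1%:R * #|{: {ffun 'I_d -> 'I_l.+1}}|%:R) ^+ d * L) /\
  forall x, unit_cube x -> (forall k, c ord0 k <= x ord0 k <= c ord0 k + r) ->
    `|F x - \sum_h th h * monomial c h x| <= (L * l.+2%:R ^+ d) * r `^ s.
Proof.
move=> cc r0; have a0 := ltW holder_exponent_gt0.
have [th [h1 h2]] := taylor_box cubeU L_ge0 a0 FL.1 holder_ball_partial_le
  holder_ball_increment cc r0.
exists th; split=> // x cx cxr.
have -> : r `^ s = r `^ alpha * r ^+ l.
  rewrite -powR_mulrn// -powRD; last by rewrite gt_eqF// subrK.
  by rewrite subrK.
exact: h2.
Qed.

End holder_approx.

(** * The upper bound *)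

Section ridge_estimator.
Context (R : realType) (d l m n : nat) (lam : R).
Hypotheses (m_gt0 : (0 < m)%N) (lam_gt0 : 0 < lam).
Local Notation idx := (grid_index d l m).

Definition design_mx (x : 'I_n -> 'rV[R]_d) : 'M[R]_(n, #|{: idx}|) :=
  \matrix_(i, j) feature (enum_val j) (x i).

Definition grid_ridge (x : 'I_n -> 'rV[R]_d) (i j : 'I_n) : R :=
  ridge_residual_mx (design_mx x) lam i j.

Lemma grid_ridge_trace x (tau : R) : tau + #|{: idx}|%:R <= n%:R ->
  tau <= \sum_i grid_ridge x i i.
Proof.
move=> h; apply: le_trans (mxtrace_ridge (design_mx x) lam_gt0).
by rewrite lerBrDr.
Qed.

Lemma measurable_grid_ridge i j :
  measurable_fun setT (fun z : n.-tuple ('rV[R]_d * R) =>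
    grid_ridge (fun i => (tnth z i).1) i j).
Proof.
apply: (measurable_ridge_residual lam_gt0 _ i j) => a b.
under eq_fun do rewrite mxE.
apply: measurableT_comp; first exact: measurable_feature.
by apply: measurableT_comp => //; exact: measurable_tnth.
Qed.

(** The piecewise polynomial with coefficients [th] is a competitor in the
    penalized least squares criterion; its penalty counts one bounded
    coefficient per feature. *)
Lemma grid_ridge_quad_le (f : 'rV[R]_d -> R) (eps Lam : R)
    (th : {ffun 'I_d -> 'I_m.+1} -> {ffun 'I_d -> 'I_l.+1} -> R) x :
  (forall y, `|f y - \sum_cg feature cg y * th cg.1 cg.2| <= eps) ->
  (forall c g, `|th c g| <= Lam) ->
  quad (grid_ridge x) (fun i => f (x i)) <=
    n%:R * eps ^+ 2 + lam * (#|{: idx}|%:R * Lam ^+ 2).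
Proof.
move=> fth thL; have sqr_le (a b : R) : `|a| <= b -> a ^+ 2 <= b ^+ 2.
  by move=> ab; rewrite -real_normK ?num_real// lerXn2r// nnegrE (le_trans _ ab).
apply: (le_trans (ridge_quad_le (design_mx x) lam_gt0 _
  (fun j => th (enum_val j).1 (enum_val j).2))).
apply: lerD.
  rewrite -[n in leRHS]card_ord mulr_natl -sumr_const; apply: ler_sum => i _.
  apply: sqr_le; apply: le_trans (fth (x i)); rewrite (big_enum_val (A := {: idx}))/=.
  by under eq_bigr do rewrite mxE.
rewrite ler_pM2l//.
rewrite -[#|_| in leRHS]card_ord mulr_natl -sumr_const; apply: ler_sum => j _.
exact: sqr_le.
Qed.

End ridge_estimator.

Section root_mean_square.
Context (R : realType) (d n : nat) (th : param R d).
Variables (est : n.-tuple ('rV[R]_d * R) -> R) (x : R).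
Hypothesis x_ge0 : 0 <= x.
Local Notation mse :=
  (\int[sample_law th n]_z ((est z - noise_variance th) ^+ 2)%:E)%E.

Let mse_ge0 : (0 <= mse)%E.
Proof. by apply: integral_ge0 => z _; rewrite lee_fin sqr_ge0. Qed.

Let rateE : x `^ 2^-1 * n%:R `^ (- 2^-1) = (x / n%:R) `^ 2^-1.
Proof. by rewrite powRM ?invr_ge0// -[n%:R^-1]powR_inv1// -powRrM mulN1r. Qed.

Lemma rmse_le_of_mse : (mse <= (x / n%:R)%:E)%E ->
  (rmse th est <= (x `^ 2^-1 * n%:R `^ (- 2^-1))%:E)%E.
Proof.
move=> h; rewrite /rmse rateE -poweR_EFin; apply: gt0_ler_poweR => //.
- by rewrite in_itv/= leey andbT.
- by rewrite in_itv/= leey andbT lee_fin divr_ge0.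
Qed.

Lemma le_rmse_of_mse : ((x / n%:R)%:E <= mse)%E ->
  ((x `^ 2^-1 * n%:R `^ (- 2^-1))%:E <= rmse th est)%E.
Proof.
move=> h; rewrite /rmse rateE -poweR_EFin; apply: gt0_ler_poweR => //.
- by rewrite in_itv/= leey andbT lee_fin divr_ge0.
- by rewrite in_itv/= leey andbT.
Qed.

End root_mean_square.

Section upper_bound.
Context (R : realType) (s : R) (d : nat) (U : set 'rV[R]_d) (pm pp L vm vp C4 : R).
Hypotheses (s_gt0 : 0 < s) (oU : open U) (cubeU : @unit_cube R d `<=` U).
Hypotheses (L_ge0 : 0 <= L) (C4_ge0 : 0 <= C4).
Local Notation l := (holder_order s).
Local Notation Theta := (model s U pm pp L vm vp C4).
Local Notation mi := {ffun 'I_d -> 'I_l.+1}.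

Let Lam : R := (l.+1%:R * #|{: mi}|%:R) ^+ d * L.
Let K : R := L * l.+2%:R ^+ d.

Let Lam_ge0 : 0 <= Lam. Proof. by rewrite mulr_ge0 ?exprn_ge0 ?mulr_ge0. Qed.
Let K_ge0 : 0 <= K. Proof. by rewrite mulr_ge0 ?exprn_ge0. Qed.

Lemma model_quad_le n m lam th x : (0 < m)%N -> 0 < lam -> Theta th ->
  quad (@grid_ridge R d l m n lam x) (fun i => regression0 th (x i)) <=
  n%:R * (K * m%:R^-1 `^ s) ^+ 2 + lam * (#|{: grid_index d l m}|%:R * Lam ^+ 2).
Proof.
move=> m0 lam0 [_ [F FL Freg] _ _].
have /choice[c cP] : forall c : {ffun 'I_d -> 'I_m.+1}, exists t : mi -> R,
    (forall h, `|t h| <= Lam) /\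
    forall x, unit_cube x ->
    (forall k, corner R c ord0 k <= x ord0 k <= corner R c ord0 k + m%:R^-1) ->
    `|F x - \sum_h t h * monomial (corner R c) h x| <= K * m%:R^-1 `^ s.
  by move=> c; apply: (holder_ball_taylor s_gt0 L_ge0 oU cubeU FL) => //;
     exact: unit_cube_corner.
apply: (@grid_ridge_quad_le R d l m n lam lam0 (regression0 th) _ Lam c x); last first.
  by move=> c' g; have [h _] := cP c'.
apply: sum_feature => //.
- by rewrite mulr_ge0// powR_ge0.
- by move=> y ny; rewrite /regression0 patchE memNset.
move=> c' y cy ycell; have [_ /(_ y cy ycell)] := cP c'.
by rewrite /regression0 patchE mem_set// Freg// inE.
Qed.

Lemma model_estimator_mse n m (lam b : R) th : (0 < m)%N -> (0 < n)%N -> 0 < lam ->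
  Theta th -> (#|{: grid_index d l m}|%:R <= n%:R / 2 :> R) ->
  n%:R * (K * m%:R^-1 `^ s) ^+ 2 + lam * (#|{: grid_index d l m}|%:R * Lam ^+ 2) <= b ->
  (\int[sample_law th n]_z
    ((quad_estimator (@grid_ridge R d l m n lam) z - noise_variance th) ^+ 2)%:E <=
  ((n%:R / 2) ^- 2 * (2 * b ^+ 2 + 2 * (12 * vp * b + 6 * n%:R * vp ^+ 2 +
     18 * (n%:R * C4))))%:E)%E.
Proof.
move=> m0 n0 lam0 Tth Kn hb.
have [_ _ moments /andP[Vm Vp]] := Tth.
have qb x := le_trans (model_quad_le x m0 lam0 Tth) hb.
have q0 x : 0 <= quad (@grid_ridge R d l m n lam x) (fun i => regression0 th (x i)).
  exact: ridge_quad_ge0.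
have n2 : 0 < n%:R / 2 :> R by rewrite divr_gt0// ltr0n.
have b0 : 0 <= b := le_trans (q0 (fun=> 0)) (qb _).
have V0 := ltW (noise_variance_gt0 th).
apply: (le_trans (@quad_estimator_mse R d n th C4 C4_ge0 moments
   (@grid_ridge R d l m n lam) _ _ _ b _ (n%:R / 2) n2 _ _ _)).
- by move=> x i j; exact: ridge_entryC.
- by move=> x i; exact: ridge_row_sqr.
- exact: measurable_grid_ridge.
- by move=> x; apply: le_trans (qb x); exact: ridge_norm_le.
- by move=> x; apply: grid_ridge_trace => //; lra.
- exact: q0.
- exact: qb.
rewrite lee_fin ler_wpM2l ?invr_ge0 ?sqr_ge0//.
have V2 : noise_variance th ^+ 2 <= vp ^+ 2 by rewrite lerXn2r// nnegrE (le_trans V0).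
rewrite lerD2l ler_pM2l// lerD2r lerD//.
  by rewrite ler_wpM2r// ler_pM2l.
by rewrite ler_wpM2l// mulr_ge0.
Qed.

Hypotheses (d_gt0 : (0 < d)%N) (d_le : d%:R <= 4 * s) (vp_ge0 : 0 <= vp).

Let kappa : nat := #|{: mi}|.
Let c0 : nat := (2 ^ d.+1 * kappa)%N.

Let kappa_gt0 : (0 < kappa)%N.
Proof. by apply/card_gt0P; exists [ffun=> ord0]. Qed.

Let c0_gt0 : (0 < c0)%N.
Proof. by rewrite muln_gt0 expn_gt0. Qed.

(** The largest [m] such that [c0 * m ^ d <= n]: the grid is coarse enough to leave
    half of the [n] degrees of freedom to the residuals, and cells contain a
    bounded number of points on average. *)
Lemma mesh_size n : (c0 <= n)%N -> exists m : nat,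
  [/\ (0 < m)%N, (2 * #|{: grid_index d l m}| <= n)%N & (n <= c0 * (2 * m) ^ d)%N].
Proof.
move=> nc0.
have ex1 : exists m, (c0 * m ^ d <= n)%N by exists 1%N; rewrite exp1n muln1.
have bnd m : (c0 * m ^ d <= n)%N -> (m <= n)%N.
  case: m => // m h; apply: leq_trans h; apply: (@leq_trans (m.+1 ^ d)).
    by rewrite -{1}[m.+1]expn1 leq_pexp2l.
  by rewrite leq_pmull.
case: (ex_maxnP ex1 bnd) => m hm mmax; exists m.
have m0 : (0 < m)%N by apply: mmax; rewrite exp1n muln1.
have m2 : (m.+1 ^ d <= (2 * m) ^ d)%N by rewrite leq_exp2r//; lia.
split=> //.
- rewrite card_prod card_ffun !card_ord -/kappa; apply: leq_trans hm.
  have -> : (c0 * m ^ d = 2 * ((2 * m) ^ d * kappa))%N.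
    by rewrite /c0 expnS expnMn -!mulnA; congr (_ * (_ * _))%N; rewrite mulnC.
  by rewrite leq_pmul2l// leq_pmul2r.
- have : ~~ (c0 * m.+1 ^ d <= n)%N by apply/negP => /mmax; rewrite ltnn.
  by rewrite -ltnNge => /ltnW h; apply: leq_trans h _; rewrite leq_pmul2l.
Qed.

Let c1 : R := c0%:R `^ 2^-1 * 2 `^ (2 * s).
Let B0 : R := K ^+ 2 * c1 + Lam ^+ 2.
Let C1 : R := 4 * (2 * B0 ^+ 2 + 24 * vp * B0 + 12 * vp ^+ 2 + 36 * C4).

Let c1_ge0 : 0 <= c1. Proof. by rewrite mulr_ge0 ?powR_ge0. Qed.
Let B0_ge0 : 0 <= B0. Proof. by rewrite addr_ge0 ?mulr_ge0 ?sqr_ge0. Qed.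
Let C1_ge0 : 0 <= C1.
Proof.
by rewrite mulr_ge0// !addr_ge0 ?mulr_ge0 ?sqr_ge0.
Qed.

(** The only place where [d <= 4 s] matters: as [n] is at most of order [m ^ d], its
    square root is at most of order [m ^ (d / 2)], hence of order [m ^ (2 s)],
    which the squared approximation error [m ^ (- 2 s)] compensates. *)
Lemma mesh_bias n m : (0 < m)%N -> (n <= c0 * (2 * m) ^ d)%N ->
  n%:R `^ 2^-1 * (m%:R^-1 `^ s) ^+ 2 <= c1.
Proof.
move=> m0 nm; have mR : 0 < m%:R :> R by rewrite ltr0n.
have -> : (m%:R^-1 `^ s) ^+ 2 = (m%:R `^ (2 * s))^-1 :> R.
  rewrite -powR_mulrn ?powR_ge0// -powRrM [s * _]mulrC -powR_inv1 ?ler0n//.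
  by rewrite -powRrM mulN1r powRN.
rewrite ler_pdivrMr ?powR_gt0//.
apply: (@le_trans _ _ ((c0%:R * (2 * m%:R) ^+ d) `^ 2^-1)).
  rewrite ge0_ler_powR// ?nnegrE ?invr_ge0 ?mulr_ge0 ?exprn_ge0 ?mulr_ge0//.
  by rewrite -natrM -natrX -natrM ler_nat.
rewrite powRM// ?exprn_ge0 ?mulr_ge0// /c1 -mulrA ler_wpM2l ?powR_ge0//.
rewrite -powRM// -powR_mulrn ?mulr_ge0// -powRrM ler_powR//.
  by rewrite -natrM ler1n muln_gt0.
by rewrite ler_pdivrMr//; apply: le_trans d_le _; rewrite mulrAC -natrM.
Qed.

Lemma minimax_le_of_est n (est : n.-tuple ('rV[R]_d * R) -> R) (a : \bar R) :
  measurable_fun setT est ->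
  (forall th, Theta th -> (rmse th est <= a)%E) ->
  (minimax_risk n Theta <= a)%E.
Proof.
move=> mest h; apply: le_trans (ereal_inf_lbound _) _; first by exists est.
by apply/ereal_supP => _ [th Tth <-]; exact: h.
Qed.

(** With penalty [n ^ (- 1 / 2)] both the approximation error and the penalty
    contribute a bias of order [sqrt n] to a quadratic form of trace at least
    [n / 2], and the standard deviation of that form is of the same order. *)
Theorem minimax_upper_bound : exists2 C : R, 0 < C &
  forall n, (0 < n)%N -> (minimax_risk n Theta <= (C * n%:R `^ (- 2^-1))%:E)%E.
Proof.
pose a := C1 + vp ^+ 2 * c0%:R + 1.
have a0 : 0 < a by rewrite ltr_pwDr// addr_ge0// mulr_ge0 ?sqr_ge0.
exists (a `^ 2^-1); first by rewrite powR_gt0.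
move=> n n0; have nR : 0 < n%:R :> R by rewrite ltr0n.
(* below [c0] observations there is no admissible grid, and the estimator 0
   has bounded error *)
have [nc0|nc0] := leqP c0 n; last first.
  apply: (@minimax_le_of_est _ (cst 0)) => // th [_ _ _ /andP[Vm Vp]].
  apply: rmse_le_of_mse => //; first exact: ltW.
  under eq_integral do rewrite sub0r sqrrN.
  rewrite -[leRHS]mule1 -(tuple_measureT (joint_law th) n) integral_cst//.
  rewrite lee_wpmul2r// ?measure_ge0// lee_fin ler_pdivlMr//.
  have V0 := ltW (noise_variance_gt0 th).
  apply: (@le_trans _ _ (vp ^+ 2 * c0%:R)).
    by rewrite ler_pM ?sqr_ge0 ?lerXn2r ?nnegrE// ler_nat ltnW.
  by rewrite /a -addrA addrCA lerDl addr_ge0.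
have [m [m0 Kn nm]] := mesh_size nc0.
pose q : R := n%:R `^ 2^-1.
have q0 : 0 < q by rewrite powR_gt0.
have qq : q * q = n%:R.
  rewrite -powRD; last by rewrite gt_eqF ?implybT.
  by rewrite -[2^-1]mul1r -splitr powRr1.
have q1 : 1 <= q by rewrite -[1](powRr0 n%:R) ler_powR// ler1n.
have lam0 : 0 < q^-1 by rewrite invr_gt0.
have KnR : #|{: grid_index d l m}|%:R <= n%:R / 2 :> R.
  by rewrite ler_pdivlMr// mulrC -natrM ler_nat.
have hb : n%:R * (K * m%:R^-1 `^ s) ^+ 2 +
    q^-1 * (#|{: grid_index d l m}|%:R * Lam ^+ 2) <= B0 * q.
  rewrite /B0 mulrDl; apply: lerD.
    rewrite -qq exprMn.
    have -> : q * q * (K ^+ 2 * (m%:R^-1 `^ s) ^+ 2) =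
              K ^+ 2 * (q * (m%:R^-1 `^ s) ^+ 2) * q by ring.
    by rewrite ler_wpM2r ?(ltW q0)// ler_wpM2l ?sqr_ge0// mesh_bias.
  rewrite ler_pdivrMl//.
  have -> : q * (Lam ^+ 2 * q) = n%:R * Lam ^+ 2 by rewrite -qq; ring.
  by rewrite ler_wpM2r ?sqr_ge0//; apply: le_trans KnR _; rewrite ler_pdivrMr// ler_peMr// ler1n.
apply: (@minimax_le_of_est _ (quad_estimator (@grid_ridge R d l m n q^-1))).
  have n2 : 0 < n%:R / 2 :> R by rewrite divr_gt0.
  have tG x : n%:R / 2 <= \sum_i @grid_ridge R d l m n q^-1 x i i.
    by apply: grid_ridge_trace => //; lra.
  have mG i j := @measurable_grid_ridge R d l m n q^-1 lam0 i j.
  exact: (measurable_quad_estimator mG n2 tG).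
move=> th Tth; apply: rmse_le_of_mse => //; first exact: ltW.
apply: le_trans (model_estimator_mse m0 n0 lam0 Tth KnR hb) _.
rewrite lee_fin; apply: (@le_trans _ _ (C1 / n%:R)); last first.
  by rewrite ler_pM2r ?invr_gt0// /a -addrA lerDl addr_ge0// mulr_ge0 ?sqr_ge0.
have -> : (n%:R / 2) ^- 2 = 4 / (n%:R * n%:R) :> R.
  by field; rewrite gt_eqF.
have -> : C1 / n%:R = 4 / (n%:R * n%:R) *
    (2 * B0 ^+ 2 + 24 * vp * B0 + 12 * vp ^+ 2 + 36 * C4) * n%:R.
  by rewrite /C1; field; rewrite gt_eqF.
rewrite -[leRHS]mulrA ler_wpM2l ?divr_ge0 ?mulr_ge0//.
rewrite -qq; have qq' : q <= q * q by rewrite ler_peMr// ltW.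
have hvB : 0 <= 24 * vp * B0 by rewrite !mulr_ge0.
have := ler_wpM2l hvB qq'; nra.
Qed.

End upper_bound.

(** * Laws with four-point noise *)

Section change_of_measure.
Context d (T : measurableType d) (R : realType).
Local Open Scope ereal_scope.

Lemma integral_tuple_prod (P : probability T R) (g : T -> R) (c : R) n :
  measurable_fun setT g -> (forall x, (0 <= g x)%R) ->
  \int[P]_x (g x)%:E = c%:E ->
  \int[tuple_measure P n]_t (\prod_i g (tnth t i))%:E = (c ^+ n)%:E.
Proof.
move=> mg g0 gc.
have mprod k : measurable_fun setT (fun t : k.-tuple T => (\prod_i g (tnth t i))%:E).
  apply/measurable_EFinP; apply: measurable_prod => i _.
  by apply: measurableT_comp => //; exact: measurable_tnth.
have p0 k (t : k.-tuple T) : 0 <= (\prod_i g (tnth t i))%:E.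
  by rewrite lee_fin prodr_ge0.
elim: n => [|n IH].
  transitivity (\int[tuple_measure P 0]_t (cst 1 t)).
    by apply: eq_integral => t _; rewrite big_ord0.
  by rewrite expr0 -[RHS]mule1 -(tuple_measureT P 0) -integral_cst.
rewrite ge0_integral_tupleS//.
have E x : \int[tuple_measure P n]_t (\prod_i g (tnth [tuple of x :: t] i))%:E =
   (c ^+ n)%:E * (g x)%:E.
  rewrite muleC -IH -ge0_integralZl//; [|exact: mprod|by rewrite lee_fin].
  apply: eq_integral => t _; rewrite big_ord_recl tnth0 EFinM; congr (_ * (_)%:E).
  by apply: eq_bigr => i _; rewrite tnthS.
under eq_integral do rewrite E.
have cn0 : (0 <= c ^+ n)%R by rewrite -lee_fin -IH; apply: integral_ge0.
rewrite ge0_integralZl//; last 2 first.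
- exact/measurable_EFinP.
- by move=> x _; rewrite lee_fin.
by rewrite gc -EFinM exprSr.
Qed.

(** Densities multiply under products. *)
Lemma tuple_measure_density (P Q : probability T R) (g : T -> R) n :
  measurable_fun setT g -> (forall x, (0 <= g x)%R) ->
  (forall f : T -> \bar R, measurable_fun setT f -> (forall x, 0 <= f x) ->
     \int[Q]_x f x = \int[P]_x ((g x)%:E * f x)) ->
  forall f : n.-tuple T -> \bar R, measurable_fun setT f -> (forall t, 0 <= f t) ->
    \int[tuple_measure Q n]_t f t =
    \int[tuple_measure P n]_t ((\prod_i g (tnth t i))%:E * f t).
Proof.
move=> mg g0 gQ.
have mprod k : measurable_fun setT (fun t : k.-tuple T => (\prod_i g (tnth t i))%:E).
  apply/measurable_EFinP; apply: measurable_prod => i _.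
  by apply: measurableT_comp => //; exact: measurable_tnth.
have p0 k (t : k.-tuple T) : 0 <= (\prod_i g (tnth t i))%:E.
  by rewrite lee_fin prodr_ge0.
elim: n => [|n IH] f mf f0.
  by apply: eq_integral => t _; rewrite big_ord0 mul1e.
pose h (t : n.+1.-tuple T) := (\prod_(i < n) g (tnth t (lift ord0 i)))%:E * f t.
have h0 t : 0 <= h t by rewrite mule_ge0// lee_fin prodr_ge0.
have mh : measurable_fun setT h.
  apply: emeasurable_funM => //; apply/measurable_EFinP; apply: measurable_prod => i _.
  by apply: measurableT_comp => //; exact: measurable_tnth.
have E x : \int[tuple_measure Q n]_t f [tuple of x :: t] =
    \int[tuple_measure P n]_t h [tuple of x :: t].
  rewrite IH//; last by apply: measurableT_comp => //; exact: measurable_cons_cst.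
  apply: eq_integral => t _; rewrite /h; congr ((_)%:E * _).
  by apply: eq_bigr => i _; rewrite tnthS.
rewrite ge0_integral_tupleS//; under eq_integral do rewrite E.
rewrite gQ; last 2 first.
- exact: measurable_ge0_integral_tupleS.
- by move=> x; exact: integral_ge0.
rewrite ge0_integral_tupleS; last 2 first.
- by apply: emeasurable_funM; [exact: mprod|exact: mf].
- by move=> t; rewrite mule_ge0.
apply: eq_integral => x _; rewrite -ge0_integralZl//; last 2 first.
- by apply: measurableT_comp => //; exact: measurable_cons_cst.
- by rewrite lee_fin g0.
apply: eq_integral => t _; rewrite /h muleA -EFinM big_ord_recl tnth0.
by [].
Qed.

End change_of_measure.

Section four_point.
Context (R : realType) (a b p q : R).
Hypotheses (p0 : 0 <= p) (q0 : 0 <= q).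
Local Open Scope ereal_scope.

Let half0 : (0 <= 2^-1 :> R)%R. Proof. by []. Qed.

Definition two_point (t : R) : set R -> \bar R :=
  measure_add (mscale (NngNum half0) (\d_ t)) (mscale (NngNum half0) (\d_ (- t)%R)).
HB.instance Definition _ t := Measure.on (two_point t).

(** A symmetric law on four points. Varying the weights moves the variance between
    [a ^+ 2] and [b ^+ 2] while the support stays fixed, so that the laws with
    positive weights are mutually absolutely continuous; and for [b] close to [a] the fourth moment is
    as close as desired to the square of the variance, the smallest possible
    value. *)
Definition four_point : set R -> \bar R :=
  measure_add (mscale (NngNum p0) (two_point a)) (mscale (NngNum q0) (two_point b)).
HB.instance Definition _ := Measure.on four_point.

Lemma ge0_integral_two_point t (f : R -> \bar R) :
  measurable_fun setT f -> (forall x, 0 <= f x) ->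
  \int[two_point t]_x f x = (2^-1)%:E * f t + (2^-1)%:E * f (- t)%R.
Proof.
move=> mf f0; rewrite /two_point ge0_integral_measure_add// !ge0_integral_mscale//.
by rewrite !integral_dirac// !diracE !mem_set// !mul1e.
Qed.

Lemma ge0_integral_four_point (f : R -> \bar R) :
  measurable_fun setT f -> (forall x, 0 <= f x) ->
  \int[four_point]_x f x =
  p%:E * ((2^-1)%:E * f a + (2^-1)%:E * f (- a)%R) +
  q%:E * ((2^-1)%:E * f b + (2^-1)%:E * f (- b)%R).
Proof.
move=> mf f0; rewrite /four_point ge0_integral_measure_add// !ge0_integral_mscale//.
by rewrite !ge0_integral_two_point.
Qed.

Lemma four_pointT : (p + q = 1)%R -> four_point setT = 1.
Proof.
move=> pq; rewrite -[LHS]mul1e -integral_cst// ge0_integral_four_point//.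
transitivity (p * (2^-1 * 1 + 2^-1 * 1) + q * (2^-1 * 1 + 2^-1 * 1))%:E; first by [].
by congr EFin; lra.
Qed.

Lemma integral_four_point_id : \int[four_point]_u u%:E = 0.
Proof.
have mid : measurable_fun setT (fun u : R => u%:E) by exact/measurable_EFinP.
rewrite integralE !ge0_integral_four_point//; last 2 first.
- exact: measurable_funeneg.
- exact: measurable_funepos.
have E (t : R) : (2^-1)%:E * (fun u : R => u%:E)^\+ t + (2^-1)%:E * (fun u : R => u%:E)^\+ (- t)%R
   = (2^-1 * Num.max t 0 + 2^-1 * Num.max (- t) 0)%:E by rewrite !funeposE -!EFin_max.
have E' (t : R) : (2^-1)%:E * (fun u : R => u%:E)^\- t + (2^-1)%:E * (fun u : R => u%:E)^\- (- t)%R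
   = (2^-1 * Num.max t 0 + 2^-1 * Num.max (- t) 0)%:E.
  by rewrite !funenegE/= -!EFin_max opprK addeC.
by rewrite !E !E' subee.
Qed.

Lemma integral_four_point_even k : ~~ odd k ->
  \int[four_point]_u (u ^+ k)%:E = (p * a ^+ k + q * b ^+ k)%:E.
Proof.
move=> ek; rewrite ge0_integral_four_point//; last 2 first.
- by apply/measurable_EFinP; exact: measurable_funX.
- by move=> u; rewrite lee_fin exprn_even_ge0.
transitivity (p * (2^-1 * a ^+ k + 2^-1 * (- a) ^+ k) +
  q * (2^-1 * b ^+ k + 2^-1 * (- b) ^+ k))%:E; first by [].
congr EFin; rewrite (exprNn a) (exprNn b) -signr_odd (negbTE ek) expr0 !mul1r; lra.
Qed.

End four_point.

Section flat_model.
Context (R : realType) (d : nat) (a b : R).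
Hypotheses (a_gt0 : 0 < a) (ab : a < b).
Local Notation cube := (@unit_cube R d).

Lemma lebesgue_rV_cube : @lebesgue_rV R d cube = 1%E.
Proof.
rewrite (_ : cube = [set x | forall k, `[0, 1]%classic (x ord0 k)]).
  rewrite (@lebesgue_rV_box R d (fun=> `[0, 1]%classic))// big1// => k _.
  by rewrite lebesgue_measure_itv/= lte01 oppr0 adde0.
by apply/seteqP; split=> x /= h k; have := h k; rewrite in_itv.
Qed.

Section parameter.
Variable q : R.
Hypotheses (q0 : 0 <= q) (q1 : 0 <= 1 - q).

Definition flat_noise : set R -> \bar R := four_point a b q1 q0.
HB.instance Definition _ := Measure.on flat_noise.
HB.instance Definition _ := Measure_isProbability.Build _ _ _ flat_noise
  (four_pointT a b q1 q0 (subrK q 1)).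

Definition flat_variance : R := (1 - q) * a ^+ 2 + q * b ^+ 2.

Lemma flat_variance_gt0 : 0 < flat_variance.
Proof.
have h : a ^+ 2 < b ^+ 2 by rewrite ltr_pXn2r ?nnegrE ?(ltW a_gt0) ?(ltW (lt_trans a_gt0 ab)).
have a2 : 0 < a ^+ 2 by rewrite exprn_gt0.
rewrite /flat_variance; have -> : (1 - q) * a ^+ 2 + q * b ^+ 2 =
  a ^+ 2 + q * (b ^+ 2 - a ^+ 2) by ring.
by rewrite ltr_pwDl// mulr_ge0// subr_ge0 ltW.
Qed.

Lemma integral_cst1_cube : (\int[@lebesgue_rV R d]_(x in cube) (1 : R)%:E = 1)%E.
Proof.
rewrite integral_cst; last exact: measurable_unit_cube.
by rewrite mul1e; exact: lebesgue_rV_cube.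
Qed.

(** The regression function is zero and the design uniform, so that only the noise
    carries information. *)
Definition flat_param : param R d := @Param R d (cst 1) (cst 0) flat_variance
  (kprobability (@measurable_cst _ _ _ _ setT (flat_noise : pprobability R R)))
  (measurable_cst _) (fun _ _ => ler01) integral_cst1_cube (measurable_cst _)
  flat_variance_gt0.

Lemma flat_regression0 x : regression0 flat_param x = 0.
Proof. by rewrite /regression0 patchE; case: ifP. Qed.

Lemma ge0_integral_flat (f : 'rV[R]_d * R -> \bar R) :
  measurable_fun setT f -> (forall z, 0 <= f z)%E ->
  (\int[joint_law flat_param]_z f z = \int[design_law flat_param]_(x in cube)
     ((1 - q)%:E * ((2^-1)%:E * f (x, a) + (2^-1)%:E * f (x, (- a)%R)) +
      q%:E * ((2^-1)%:E * f (x, b) + (2^-1)%:E * f (x, (- b)%R))))%E.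
Proof.
move=> mf f0; rewrite ge0_integral_joint//; apply: eq_integral => x _.
have mfx : measurable_fun setT (fun u : R => f (x, u)).
  by apply: measurableT_comp => //; exact: measurable_pair1.
under eq_integral do rewrite flat_regression0 add0r.
exact: (ge0_integral_four_point a b q1 q0 mfx (fun u => f0 _)).
Qed.

End parameter.

Variable q : R.
Hypotheses (q0 : 0 <= q) (q1 : 0 <= 1 - q).

Lemma half_ge0 : 0 <= 2^-1 :> R. Proof. by []. Qed.
Lemma onem_half_ge0 : 0 <= 1 - 2^-1 :> R. Proof. lra. Qed.

(** The density, with respect to the parameter 1/2, of the law of one observation
    with parameter [q]: the ratio of the weights of the atoms. *)
Definition flat_density (z : 'rV[R]_d * R) : R :=
  2 * (1 - q) + (2 * q - 2 * (1 - q)) * \1_([set b] `|` [set - b]) z.2.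

Let th0 := flat_param half_ge0 onem_half_ge0.
Let th1 := flat_param q0 q1.

Lemma measurable_flat_density : measurable_fun setT flat_density.
Proof.
apply: measurable_funD => //; apply: measurable_funM => //.
by apply: measurableT_comp => //; apply: measurable_indic; exact: measurableU.
Qed.

Let density_b x : flat_density (x, b) = 2 * q.
Proof. by rewrite /flat_density indicE mem_set/=; [lra|left]. Qed.
Let density_Nb x : flat_density (x, - b) = 2 * q.
Proof. by rewrite /flat_density indicE mem_set/=; [lra|right]. Qed.
Let density_a x : flat_density (x, a) = 2 * (1 - q).
Proof.
rewrite /flat_density indicE memNset/=; first by lra.
by have := a_gt0; have := ab; move=> ? ? [|] /= ?; lra.
Qed.
Let density_Na x : flat_density (x, - a) = 2 * (1 - q).
Proof.
rewrite /flat_density indicE memNset/=; first by lra.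
by have := a_gt0; have := ab; move=> ? ? [|] /= ?; lra.
Qed.

Lemma flat_density_ge0 z : 0 <= flat_density z.
Proof.
rewrite /flat_density indicE; have := q0; have := q1.
by case: (_ \in _) => /= ? ?; lra.
Qed.

Lemma flat_change_of_measure (f : 'rV[R]_d * R -> \bar R) :
  measurable_fun setT f -> (forall z, 0 <= f z)%E ->
  (\int[joint_law th1]_z f z = \int[joint_law th0]_z ((flat_density z)%:E * f z))%E.
Proof.
move=> mf f0; have mg := measurable_flat_density; have g0 := flat_density_ge0.
rewrite !ge0_integral_flat//; last 2 first.
- by apply: emeasurable_funM => //; exact/measurable_EFinP.
- by move=> z; rewrite mule_ge0// lee_fin.
apply: eq_integral => x _; rewrite density_a density_Na density_b density_Nb.
have E (c : R) (y : \bar R) : (2^-1%:E * ((2 * c)%:E * y) = c%:E * y)%E.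
  by rewrite muleA -EFinM mulKf.
rewrite !E -!ge0_muleDr ?f0// !muleA -!EFinM.
by congr ((_)%:E * _ + (_)%:E * _)%E; lra.
Qed.

Lemma integral_flat_density :
  (\int[joint_law th0]_z (flat_density z)%:E = 1)%E.
Proof.
transitivity (\int[joint_law th1]_z (cst 1 z))%E.
  by rewrite flat_change_of_measure//; apply: eq_integral => z _; rewrite mule1.
by rewrite -[RHS]mule1 -(probability_setT (joint_law th1)) -integral_cst.
Qed.

Lemma integral_flat_density_sqr :
  (\int[joint_law th0]_z (flat_density z ^+ 2)%:E = (2 * (1 - q) ^+ 2 + 2 * q ^+ 2)%:E)%E.
Proof.
rewrite ge0_integral_flat//; last 2 first.
- by apply/measurable_EFinP; apply: measurable_funX; exact: measurable_flat_density.
- by move=> z; rewrite lee_fin sqr_ge0.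
transitivity (\int[design_law th0]_(x in cube)
   (cst (2 * (1 - q) ^+ 2 + 2 * q ^+ 2)%:E x))%E.
  apply: eq_integral => x _; rewrite density_a density_Na density_b density_Nb.
  by rewrite /cst -!EFinM -!EFinD; congr EFin; field.
rewrite integral_cst; last exact: measurable_unit_cube.
by rewrite [X in (_ * X)%E]design_law_cube mule1.
Qed.

Section membership.
Variables (s : R) (U : set 'rV[R]_d) (pm pp L vm vp C4 : R).
Hypotheses (pm1 : pm <= 1) (pp1 : 1 <= pp) (L_ge0 : 0 <= L).
Hypotheses (va : vm <= a ^+ 2) (vb : b ^+ 2 <= vp) (C4b : b ^+ 4 <= C4).

Lemma iterated_partial_cst0 (w : seq 'I_d) :
  iterated_partial w (cst 0 : 'rV[R]_d -> R) = cst 0.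
Proof.
elim: w => // i w IH; rewrite /iterated_partial/= -/(iterated_partial w _) IH.
by apply/funext => x; rewrite derive_cst.
Qed.

Lemma holder_ball_cst0 : holder_ball s U L (cst 0).
Proof.
have p0 l (g : {ffun 'I_d -> 'I_l.+1}) : partial_mi g (cst 0 : 'rV[R]_d -> R) = cst 0.
  exact: iterated_partial_cst0.
split=> [w _ x _|].
  rewrite iterated_partial_cst0; split; first exact: cst_continuous.
  by move=> _ i; exact: derivable_cst.
rewrite /holder_norm big1 ?add0e => [|g _]; last first.
  rewrite p0 (_ : EFin \o _ = cst 0%E) ?Lnorm0//.
  by apply/funext => x; rewrite /= patchE; case: ifP.
apply/bigmax_leP; split; first by rewrite lee_fin.
move=> g _; apply/ereal_supP => _ [u [v [_ _ _ ->]]].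
by rewrite p0 subrr normr0 mul0r lee_fin.
Qed.

Lemma flat_model : model s U pm pp L vm vp C4 th1.
Proof.
have a0 := ltW a_gt0.
have ab2 : a ^+ 2 <= b ^+ 2 by rewrite lerXn2r ?nnegrE ?(ltW ab) ?(ltW a_gt0) ?(ltW (lt_trans a_gt0 ab)).
split.
- by apply: aeW => x _ /=; apply/andP.
- by exists (cst 0) => //; exact: holder_ball_cst0.
- apply: aeW => x _; split.
  + exact: integral_four_point_id.
  + by rewrite [LHS](integral_four_point_even a b q1 q0).
  + rewrite [leLHS](integral_four_point_even a b q1 q0)// lee_fin.
    have a4 : a ^+ 4 <= b ^+ 4 by rewrite lerXn2r ?nnegrE ?(ltW ab) ?(ltW a_gt0) ?(ltW (lt_trans a_gt0 ab)).
    have := q0; have := q1; have := C4b; nra.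
- rewrite /= /flat_variance; have := va; have := vb; have := q0; have := q1.
  by move=> ? ? ? ?; apply/andP; split; nra.
Qed.

End membership.
End flat_model.

(** * The lower bound *)

Section two_point_bound.
Context (R : realType).

(** Minimizing over [T] gives [(V1 - V0)^2 * g / (1 + g)], and [1 / (1 + g)] lies
    above its tangent [(3 - g) / 4] at [g = 1]. *)
Lemma two_point_ineq (T V0 V1 g : R) : 0 <= g ->
  3 / 4 * (V1 - V0) ^+ 2 * g <=
  (T - V0) ^+ 2 + g * (T - V1) ^+ 2 + (V1 - V0) ^+ 2 / 4 * g ^+ 2.
Proof.
move=> g0; rewrite -subr_ge0 -(pmulr_rge0 _ (ltr_pwDl ltr01 g0)).
have -> : (1 + g) * ((T - V0) ^+ 2 + g * (T - V1) ^+ 2 +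
    (V1 - V0) ^+ 2 / 4 * g ^+ 2 - 3 / 4 * (V1 - V0) ^+ 2 * g) =
  (T - V0 + g * (T - V1)) ^+ 2 + g * ((V1 - V0) ^+ 2 * (g - 1) ^+ 2) / 4.
  by field.
by rewrite addr_ge0 ?sqr_ge0// divr_ge0// mulr_ge0// mulr_ge0 ?sqr_ge0.
Qed.

(** By induction on [k <= n], [(1 + 1 / (2 n)) ^ k <= 1 + k / n]. *)
Lemma bernoulli_power (n : nat) : (0 < n)%N -> (1 + (2 * n%:R)^-1) ^+ n <= 2 :> R.
Proof.
move=> n0; have nR : 0 < n%:R :> R by rewrite ltr0n.
suff H k : (k <= n)%N -> (1 + (2 * n%:R)^-1) ^+ k <= 1 + k%:R / n%:R :> R.
  by apply: le_trans (H n (leqnn n)) _; rewrite divff ?gt_eqF.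
elim: k => [|k IH] kn; first by rewrite expr0 mul0r addr0.
have kR : k%:R <= n%:R :> R by rewrite ler_nat ltnW.
have h0 : 0 <= 1 + (2 * n%:R)^-1 :> R by rewrite addr_ge0// invr_ge0 mulr_ge0// ltW.
rewrite exprSr; apply: le_trans (ler_wpM2r h0 (IH (ltnW kn))) _.
have -> : (1 + k%:R / n%:R) * (1 + (2 * n%:R)^-1) =
  1 + k.+1%:R / n%:R - (n%:R - k%:R) / (2 * n%:R ^+ 2) :> R.
  by rewrite -natr1; field; rewrite gt_eqF.
by rewrite gerBl divr_ge0 ?subr_ge0// mulr_ge0// sqr_ge0.
Qed.

Lemma le_add_or (x y z : \bar R) : (x + x <= y + z -> x <= y \/ x <= z)%E.
Proof.
have [xy|yx] := leP x y; first by left.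
have [xz|zx] := leP x z; first by right.
by rewrite leNgt lteD.
Qed.

(** Le Cam's two-point method: if [G] is the density of a second law with respect to
    [P], the two quadratic risks cannot both be small unless the second moment of
    [G] is large. *)
Lemma two_point_mse d (T : measurableType d) (P : {measure set T -> \bar R})
    (G est : T -> R) (V0 V1 : R) :
  measurable_fun setT G -> (forall z, 0 <= G z) -> measurable_fun setT est ->
  (\int[P]_z (G z)%:E = 1)%E -> (\int[P]_z (G z ^+ 2)%:E <= 2%:E)%E ->
  (((V1 - V0) ^+ 2 / 4)%:E <= \int[P]_z ((est z - V0) ^+ 2)%:E +
     \int[P]_z ((G z)%:E * ((est z - V1) ^+ 2)%:E))%E.
Proof.
move=> mG G0 mest IG IG2.
set mse0 := (\int[P]_z ((est z - V0) ^+ 2)%:E)%E.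
set mse1 := (X in (_ <= _ + X)%E).
have msq V : measurable_fun setT (fun z => ((est z - V) ^+ 2)%:E).
  by apply/measurable_EFinP; apply: measurable_funX; exact: measurable_funB.
have sq0 V z : (0 <= ((est z - V) ^+ 2)%:E)%E by rewrite lee_fin sqr_ge0.
pose D := (V1 - V0) ^+ 2.
have D0 : 0 <= D by exact: sqr_ge0.
have h : ((3 / 4 * D)%:E <= mse0 + mse1 + (D / 4)%:E * 2%:E)%E.
  have -> : (3 / 4 * D)%:E = (\int[P]_z ((3 / 4 * D)%:E * (G z)%:E))%E.
    rewrite ge0_integralZl; first by rewrite IG mule1.
    - exact: measurableT.
    - exact/measurable_EFinP.
    - by move=> z _; rewrite lee_fin; exact: G0.
    - by rewrite lee_fin mulr_ge0.
  apply: (@le_trans _ _ (\int[P]_z (((est z - V0) ^+ 2)%:E +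
     (G z)%:E * ((est z - V1) ^+ 2)%:E + (D / 4)%:E * (G z ^+ 2)%:E))%E).
    apply: ge0_le_integral => //.
    - by move=> z _; rewrite mule_ge0// lee_fin ?G0// mulr_ge0.
    - by apply: measurable_funeM; exact/measurable_EFinP.
    - apply: emeasurable_funD; first apply: emeasurable_funD => //.
        by apply: emeasurable_funM => //; exact/measurable_EFinP.
      by apply: measurable_funeM; apply/measurable_EFinP; exact: measurable_funX.
    - by move=> z _; rewrite -!EFinM -!EFinD lee_fin; exact: two_point_ineq.
  have mGe : measurable_fun setT (fun z => (G z)%:E * ((est z - V1) ^+ 2)%:E)%E.
    by apply: emeasurable_funM => //; exact/measurable_EFinP.
  have mG2 : measurable_fun setT (fun z => (G z ^+ 2)%:E).
    by apply/measurable_EFinP; exact: measurable_funX.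
  have D4 : 0 <= D / 4 by rewrite divr_ge0.
  rewrite ge0_integralD//; last 4 first.
  - by move=> z _; rewrite adde_ge0// mule_ge0// lee_fin.
  - by apply: emeasurable_funD.
  - by move=> z _; rewrite mule_ge0// lee_fin sqr_ge0.
  - exact: measurable_funeM.
  rewrite ge0_integralD//; last by move=> z _; rewrite mule_ge0// lee_fin.
  rewrite ge0_integralZl//; last by move=> z _; rewrite lee_fin sqr_ge0.
  by rewrite leeD2l// lee_wpmul2l.
have -> : (D / 4)%:E = ((3 / 4 * D)%:E - ((D / 4)%:E * 2%:E))%E.
  by rewrite -EFinM -EFinB; congr EFin; field.
by rewrite leeBlDr.
Qed.

End two_point_bound.

Section lower_bound.
Context (R : realType) (d : nat) (a b : R).
Hypotheses (a_gt0 : 0 < a) (ab : a < b).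

Definition flat_half : param R d :=
  flat_param d a_gt0 ab (half_ge0 R) (onem_half_ge0 R).

Definition sample_mse n (th : param R d) (est : n.-tuple ('rV[R]_d * R) -> R) : \bar R :=
  (\int[sample_law th n]_z ((est z - noise_variance th) ^+ 2)%:E)%E.

Lemma two_point_mse_sum n (q : R) (q0 : 0 <= q) (q1 : 0 <= 1 - q)
    (est : n.-tuple ('rV[R]_d * R) -> R) :
  (2 * (1 - q) ^+ 2 + 2 * q ^+ 2) ^+ n <= 2 -> measurable_fun setT est ->
  (((noise_variance (flat_param d a_gt0 ab q0 q1) - noise_variance flat_half) ^+ 2 / 4)%:E
    <= sample_mse flat_half est + sample_mse (flat_param d a_gt0 ab q0 q1) est)%E.
Proof.
move=> q2 mest; set th0 := flat_half; set th1 := flat_param d a_gt0 ab q0 q1.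
set V0 := noise_variance th0; set V1 := noise_variance th1.
pose P := tuple_measure (joint_law th0) n.
pose G (z : n.-tuple ('rV[R]_d * R)) := \prod_i flat_density b q (tnth z i).
have mg := @measurable_flat_density R d b q.
have g0 (z : 'rV[R]_d * R) : 0 <= flat_density b q z by exact: flat_density_ge0.
have G0 z : 0 <= G z by apply: prodr_ge0.
have mG : measurable_fun setT G.
  apply: measurable_prod => i _; apply: measurableT_comp => //; exact: measurable_tnth.
have msq V : measurable_fun setT (fun z => ((est z - V) ^+ 2)%:E).
  by apply/measurable_EFinP; apply: measurable_funX; exact: measurable_funB.
have sq0 V z : (0 <= ((est z - V) ^+ 2)%:E)%E by rewrite lee_fin sqr_ge0.
have chg (f : 'rV[R]_d * R -> \bar R) :
    measurable_fun setT f -> (forall z, 0 <= f z)%E ->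
    (\int[joint_law th1]_z f z = \int[joint_law th0]_z ((flat_density b q z)%:E * f z))%E.
  exact: flat_change_of_measure.
have mse1 : sample_mse th1 est = (\int[P]_z ((G z)%:E * ((est z - V1) ^+ 2)%:E))%E.
  exact: (@tuple_measure_density _ _ R (joint_law th0) (joint_law th1)
    (flat_density b q) n mg g0 chg _ (msq V1) (sq0 V1)).
have IG : (\int[P]_z (G z)%:E = 1)%E.
  have := @integral_tuple_prod _ _ R (joint_law th0) (flat_density b q) 1 n mg g0.
  by rewrite expr1n; apply; exact: integral_flat_density.
have IG2 : (\int[P]_z (G z ^+ 2)%:E <= 2%:E)%E.
  have I2 := integral_flat_density_sqr d a_gt0 ab q.
  have := @integral_tuple_prod _ _ R (joint_law th0) (fun z => flat_density b q z ^+ 2)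
     _ n (measurable_funX 2 mg) (fun z => sqr_ge0 _) I2.
  rewrite (eq_integral (fun z => (G z ^+ 2)%:E)) => [->//|z _].
  by rewrite /G -prodrXl.
rewrite mse1 /sample_mse /sample_law.
exact: (@two_point_mse _ _ _ P G est V0 V1 mG G0 mest IG IG2).
Qed.

Variables (s : R) (U : set 'rV[R]_d) (pm pp L vm vp C4 : R).
Hypotheses (pm1 : pm <= 1) (pp1 : 1 <= pp) (L_ge0 : 0 <= L).
Hypotheses (va : vm <= a ^+ 2) (vb : b ^+ 2 <= vp) (C4b : b ^+ 4 <= C4).
Local Notation Theta := (model s U pm pp L vm vp C4).

(** Weights that differ by [1 / sqrt (8 n)] give variances that differ by a multiple
    of [n ^ (- 1 / 2)] while the likelihood ratio of the samples has second moment
    [(1 + 1 / (2 n)) ^ n], at most 2. *)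
Theorem minimax_lower_bound : exists2 c : R, 0 < c &
  forall n, (0 < n)%N -> ((c * n%:R `^ (- 2^-1))%:E <= minimax_risk n Theta)%E.
Proof.
pose eta := b ^+ 2 - a ^+ 2.
have eta0 : 0 < eta by rewrite subr_gt0 ltr_pXn2r ?nnegrE ?(ltW a_gt0) ?(ltW (lt_trans a_gt0 ab)).
exists ((eta ^+ 2 / 64) `^ 2^-1); first by rewrite powR_gt0// divr_gt0// exprn_gt0.
move=> n n0; have nR : 0 < n%:R :> R by rewrite ltr0n.
pose e : R := Num.sqrt (8 * n%:R)^-1.
have e2 : e ^+ 2 = (8 * n%:R)^-1 by rewrite sqr_sqrtr// invr_ge0 mulr_ge0// ltW.
have e0 : 0 <= e by exact: sqrtr_ge0.
have e1 : e <= 2^-1.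
  rewrite -(@ler_pXn2r _ 2)// ?nnegrE// e2 exprVn lef_pV2 ?posrE ?mulr_gt0 ?exprn_gt0//.
  have : 1 <= n%:R :> R by rewrite ler1n.
  by lra.
have q0 : 0 <= 2^-1 + e by rewrite addr_ge0.
have q1 : 0 <= 1 - (2^-1 + e) by lra.
apply/ereal_infP => _ [est mest <-].
pose th0 := flat_half.
pose th1 := flat_param d a_gt0 ab q0 q1.
have T0 : Theta th0 by exact: flat_model.
have T1 : Theta th1 by exact: flat_model.
have chi : (2 * (1 - (2^-1 + e)) ^+ 2 + 2 * (2^-1 + e) ^+ 2) ^+ n <= 2.
  have -> : 2 * (1 - (2^-1 + e)) ^+ 2 + 2 * (2^-1 + e) ^+ 2 = 1 + (2 * n%:R)^-1.
    have -> : 2 * (1 - (2^-1 + e)) ^+ 2 + 2 * (2^-1 + e) ^+ 2 = 1 + 4 * e ^+ 2 by field.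
    by rewrite e2; field; rewrite gt_eqF.
  exact: bernoulli_power.
have := @two_point_mse_sum n _ q0 q1 est chi mest.
rewrite -/th0 -/th1.
have -> : (noise_variance th1 - noise_variance th0) ^+ 2 / 4 =
    eta ^+ 2 / 64 / n%:R + eta ^+ 2 / 64 / n%:R.
  have -> : noise_variance th1 - noise_variance th0 = e * eta.
    by rewrite /= /flat_variance /eta; field.
  by rewrite exprMn e2; field; rewrite gt_eqF.
rewrite EFinD.
set m0 := (X in (_ <= X + _)%E); set m1 := (X in (_ <= _ + X)%E); set x := (_ / n%:R)%:E.
move=> sum_ge.
have x64 : 0 <= eta ^+ 2 / 64 by rewrite divr_ge0 ?sqr_ge0.
have [h|h] := le_add_or sum_ge.
  apply: le_trans (le_rmse_of_mse x64 h) _.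
  by apply: ereal_sup_ubound; exists th0.
apply: le_trans (le_rmse_of_mse x64 h) _.
by apply: ereal_sup_ubound; exists th1.
Qed.

End lower_bound.

(** * The minimax rate *)

Theorem theorem1p4 (R : realType) (s : R) (d : nat) (U : set 'rV[R]_d)
    (pm pp L vm vp C4 : R) :
  1 < s -> (1 <= d)%N -> d%:R <= 4 * s ->
  open U -> @unit_cube R d `<=` U ->
  0 < pm -> pm < 1 -> 1 < pp -> 0 < L -> 0 < vm -> vm < vp -> vm ^+ 2 < C4 ->
  exists2 C : R, 0 < C &
    forall n : nat, (1 <= n)%N ->
      ((C^-1 * n%:R `^ (- 2^-1))%:E
         <= minimax_risk n (model s U pm pp L vm vp C4)
         <= (C * n%:R `^ (- 2^-1))%:E)%E.
Proof.
move=> s1 d1 d4 oU cubeU pm0 pm1 pp1 L0 vm0 vmp vmC.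
have C40 : 0 < C4 by apply: le_lt_trans vmC; exact: sqr_ge0.
have s0 : 0 < s := lt_trans ltr01 s1.
have vp0 : 0 < vp := lt_trans vm0 vmp.
have [Cu Cu0 upper] := minimax_upper_bound pm pp vm s0 oU cubeU (ltW L0) (ltW C40)
  d1 d4 (ltW vp0).
(* the larger support point is limited both by [vp], through the second moment,
   and by [C4], through the fourth one *)
pose a := Num.sqrt vm; pose b2 := Num.min vp (Num.sqrt C4); pose b := Num.sqrt b2.
have vmC' : vm < Num.sqrt C4.
  by rewrite -[vm]ger0_norm ?ltW// -sqrtr_sqr ltr_sqrt.
have b2vm : vm < b2 by rewrite lt_min vmp.
have a0 : 0 < a by rewrite sqrtr_gt0.
have ab : a < b by rewrite ltr_sqrt// (lt_trans vm0).
have aE : a ^+ 2 = vm by rewrite sqr_sqrtr// ltW.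
have bE : b ^+ 2 = b2 by rewrite sqr_sqrtr// ltW// (lt_trans vm0).
have b4 : b ^+ 4 <= C4.
  rewrite (exprM b 2 2) bE -[leRHS](@sqr_sqrtr _ C4) ?(ltW C40)//.
  by rewrite lerXn2r ?nnegrE ?sqrtr_ge0 ?ge_min ?lexx ?orbT// ltW// (lt_trans vm0).
have vma : vm <= a ^+ 2 by rewrite aE.
have bvp : b ^+ 2 <= vp by rewrite bE ge_min lexx.
have [c c0 lower] := minimax_lower_bound a0 ab s U (ltW pm1) (ltW pp1) (ltW L0)
  vma bvp b4.
exists (Cu + c^-1); first by rewrite addr_gt0// invr_gt0.
move=> n n1; apply/andP; split.
  apply: le_trans (lower n n1); rewrite lee_fin ler_wpM2r ?powR_ge0//.
  by rewrite invf_ple ?posrE ?addr_gt0 ?invr_gt0// lerDr ltW.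
apply: (le_trans (upper n n1)); rewrite lee_fin ler_wpM2r ?powR_ge0//.
by rewrite lerDl invr_ge0 ltW.
Qed.
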